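(* Let $\mathcal{M}\subseteq\mathbb{R}^N$ be a smoothly embedded compact manifold with $\mathrm{reach}(\mathcal{M})=\tau>0$, let $\ell>0$, and let $f:\mathcal{M}\to\mathsf{Gr}(d,n)$ be an $\ell$-Lipschitz map with respect to the Euclidean distance on $\mathcal{M}$ and the Frobenius distance on $\mathsf{Gr}(d,n)$. Let $P\subseteq\mathbb{R}^N$ be a finite set and let $g:P\to\mathsf{Gr}(d,n)$ be a function. Let $\epsilon,\delta>0$ be such that - for every $x\in\mathcal{M}$ there exists $p\in P$ such that $\|p-x\|_2<\epsilon$; - for every $p\in P$ there exists $x\in\mathcal{M}$ such that $\|p-x\|_2<\epsilon$ and $\|g(p)-f(x)\|<\delta$. Then $g$ is a $2(\delta+\ell\epsilon)$-approximate $\ell$-Lipschitz map. If moreover $\epsilon<(3-\sqrt8)\tau$, then, for every $$\alpha\in\left(\frac{(\epsilon+\tau)-\sqrt{\epsilon^2+\tau^2-6\tau\epsilon}}{2},\ \frac{(\epsilon+\tau)+\sqrt{\epsilon^2+\tau^2-6\tau\epsilon}}{2}\right)\cap\left(0,\ \frac{\sqrt2/2-2\delta-2\ell\epsilon}{2\ell}\right),$$ the inclusion $j:\mathsf{Gr}(d,n)\hookrightarrow\mathsf{Gr}(d,n)^{2(\ell\alpha+\ell\epsilon+\delta)}$ is a homotopy equivalence and there exists a homotopy equivalence $h:\mathcal{M}\to\check{\mathsf C}(P)(\alpha)$ such that $\check{\mathsf C}(g)(\alpha)\circ h$ is homotopic to $j\circ f$ as maps $\mathcal{M}\to\mathsf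{Gr}(d,n)^{2(\ell\alpha+\ell\epsilon+\delta)}$.
   Context: $\|\cdot\|$ is the Frobenius norm on matrices, $\|\cdot\|_2$ the Euclidean norm. $\mathsf{Gr}(d,n)=\{A\in\mathbb{R}^{n\times n}:A=A^t=A^2,\ \mathrm{rank}\,A=d\}$ with the Frobenius distance; for $r>0$, $\mathsf{Gr}(d,n)^r\subseteq\mathbb{R}^{n\times n}$ is the set of matrices at Frobenius distance $<r$ from some element of $\mathsf{Gr}(d,n)$. The reach of a nonempty closed $X\subseteq\mathbb{R}^N$ is the supremum of the $r\geq0$ such that no point in the $r$-thickening $X^r$ of $X$ (points at distance $<r$ from $X$; $X^0=X$) has more than one closest point in $X$. A function $g:X\to Y$ between metric spaces is a $\delta$-approximate $\ell$-Lipschitz map if $d_Y(g(x),g(x'))\leq\ell d_X(x,x')+\delta$ for all $x,x'\in X$. For $X\subseteq\mathbb{R}^N$ finite and $\alpha>0$, the Čech complex $\check{\mathsf C}(X)(\alpha)$ is (the geometric realization of) the nerve of the cover $\{B(x,\alpha)\}_{x\in X}$ by open balls in $\mathbb{R}^N$: its vertices are the elements of $X$ and its points are formal convex combinations $\sum_{x}c_x[x]$ with $\bigcap_{x:c_x>0}B(x,\alpha)\neq\emptyset$. If $g:X\to\mathsf{Gr}(d,n)$ is a $\delta'$-approximate $\ell$-Lipschitz map, then $\check{\mathsf C}(g)(\alpha):\check{\mathsf C}(X)(\alpha)\to\mathsf{Gr}(d,n)^{2\ell\alpha+\delta'}$ is the continuous map $\sum_xc_x[x]\mapsto\sum_xc_xg(x)$.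 *)

(* Defs.v *)
From HB Require Import structures.
From mathcomp Require Export all_boot all_order all_algebra.
From mathcomp Require Export all_classical all_reals all_analysis.
Export numFieldNormedType.Exports.
Import Order.TTheory GRing.Theory Num.Theory.

Set Implicit Arguments.
Unset Strict Implicit.
Unset Printing Implicit Defensive.

Local Open Scope classical_set_scope.
Local Open Scope ring_scope.

(* The library norm [`|A|] on matrices is the sup norm.  It induces the same
   topology as [frob], which is the Euclidean norm on row vectors. *)
Definition frob (R : realType) (m n : nat) (A : 'M[R]_(m, n)) : R :=
  Num.sqrt (\sum_(i < m) \sum_(j < n) A i j ^+ 2).

Section Metric.
Context {R : realType}.

Definition thickening (m n : nat) (X : set 'M[R]_(m, n)) (r : R) :
    set 'M[R]_(m, n) :=
  if r == 0 then X else [set y | exists2 x, X x & frob (y - x) < r].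

Definition closest_point (m n : nat) (X : set 'M[R]_(m, n))
    (y x : 'M[R]_(m, n)) : Prop :=
  X x /\ forall x', X x' -> frob (y - x) <= frob (y - x').

(* Infinite exactly when closest points are unique everywhere. *)
Definition reach (m n : nat) (X : set 'M[R]_(m, n)) : \bar R :=
  ereal_sup [set r%:E | r in [set r : R | 0 <= r /\
    forall y x x', thickening X r y ->
      closest_point X y x -> closest_point X y x' -> x = x']].

(* A map with domain a subset [A] is a total function whose values outside [A]
   are irrelevant. *)
Definition approx_lipschitz (delta ell : R) (m n p q : nat)
    (A : set 'M[R]_(m, n)) (g : 'M[R]_(m, n) -> 'M[R]_(p, q)) : Prop :=
  forall x x', A x -> A x' -> frob (g x - g x') <= ell * frob (x - x') + delta.

Definition lipschitz_map (ell : R) (m n p q : nat)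
    (A : set 'M[R]_(m, n)) (f : 'M[R]_(m, n) -> 'M[R]_(p, q)) : Prop :=
  forall x x', A x -> A x' -> frob (f x - f x') <= ell * frob (x - x').

Definition Gr (d n : nat) : set 'M[R]_n :=
  [set A | [/\ A = A^T, A = A *m A & \rank A = d]].

End Metric.

Arguments Gr {R} d n.

Section Manifold.
Context {R : realType}.

(* On an open set [U], [f] is C^k: for k = k'.+1, all directional derivatives
   exist on [U] and are C^k' there. *)
Fixpoint Ck_on (V W : normedModType R) (k : nat) (U : set V) (f : V -> W) :
    Prop :=
  match k with
  | 0%N => forall x, U x -> {for x, continuous f}
  | k'.+1 => (forall x v, U x -> derivable f x v) /\
             (forall v, Ck_on k' U (fun x => 'D_v f x))
  end.

Definition smooth_on (V W : normedModType R) (U : set V) (f : V -> W) : Prop :=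
  forall k, Ck_on k U f.

(* Embedded submanifolds without boundary, through slice charts: near each
   point, a diffeomorphism [phi] (with inverse [psi]) between open sets [U] and
   [V] of R^N straightens [M] to R^m x 0. *)
Definition smooth_submanifold (N m : nat) (M : set 'rV[R]_N) : Prop :=
  (m <= N)%N /\
  forall x, M x ->
    exists (U V : set 'rV[R]_N) (phi psi : 'rV[R]_N -> 'rV[R]_N),
      [/\ open U /\ open V,
          U x,
          [/\ set_fun U V phi, set_fun V U psi,
              {in U, cancel phi psi} & {in V, cancel psi phi}],
          smooth_on U phi /\ smooth_on V psi &
          phi @` (U `&` M) =
            V `&` [set y | forall i : 'I_N, (m <= i)%N -> y 0 i = 0]].

End Manifold.

Section Homotopy.
Context {R : realType}.

Definition homotopic (X Y : topologicalType) (A : set X) (B : set Y)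
    (f0 f1 : X -> Y) : Prop :=
  exists H : R * X -> Y,
    [/\ {within `[0, 1]%classic `*` A, continuous H},
        set_fun (`[0, 1]%classic `*` A) B H,
        (forall x, A x -> H (0, x) = f0 x) &
        (forall x, A x -> H (1, x) = f1 x)].

Definition homotopy_equivalence (X Y : topologicalType) (A : set X) (B : set Y)
    (h : X -> Y) : Prop :=
  [/\ set_fun A B h, {within A, continuous h} &
      exists k : Y -> X,
        [/\ set_fun B A k, {within B, continuous k},
            homotopic A A (k \o h) idfun &
            homotopic B B (h \o k) idfun]].

End Homotopy.

Arguments homotopic R {X Y} A B f0 f1.
Arguments homotopy_equivalence R {X Y} A B h.

Section Cech.
Context {R : realType}.

(* The formal combination with coefficients [c] is the function [c], which
   vanishes off [P].  As [P] is finite, the topology of pointwise convergence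
   restricts to the usual topology of R^P. *)
Definition cech (N : nat) (P : set 'rV[R]_N) (alpha : R) :
    set {ptws 'rV[R]_N -> R} :=
  [set c | [/\ forall x, 0 <= c x,
               forall x, ~ P x -> c x = 0,
               \sum_(x \in P) c x = 1 &
               exists y : 'rV[R]_N, forall x, 0 < c x -> frob (y - x) < alpha]].

Definition cech_map (N n : nat) (P : set 'rV[R]_N)
    (g : 'rV[R]_N -> 'M[R]_n) (c : {ptws 'rV[R]_N -> R}) : 'M[R]_n :=
  \sum_(x \in P) c x *: g x.

End Cech.

(* Main.v *)
Require Import Defs.
From mathcomp Require Import finmap ring lra.
Import Order.TTheory GRing.Theory Num.Theory.

(* The inclusion of Gr(d, n) is handled by nearest-point projection: a compact
   set X whose points at distance < r have a unique closest point is a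
   deformation retract of its r-thickening.  For Gr(d, n) one may take
   r = sqrt 2 / 2: if P is closest to A then A - P is orthogonal to the tangent
   space at P, and the normal part of Q - P has norm at most
   |Q - P|^2 / sqrt 2 for any other projection Q of the same rank.

   For M, a compactness argument replacing the gradient flow of the distance
   function gives Federer's inequality
   2 tau <x' - x, y - x> <= |x' - x|^2 |y - x|  for x the projection of y.
   With it, the segment from a point of the union U of the balls B(p, alpha) to
   its projection on M stays in U (Niyogi, Smale, Weinberger), so M is a
   deformation retract of U.  A partition of unity gives a map from U to the
   Cech complex.  In the other direction, a point c is sent to an average of
   finitely many witness points lying in all the balls B(p, alpha) for which c p
   exceeds a small threshold.  Truncating c at that threshold gives a map
   homotopic both to the identity and to the round trip through U, by
   straight-line homotopies. *)

Set Implicit Arguments.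
Unset Strict Implicit.
Unset Printing Implicit Defensive.

Local Open Scope classical_set_scope.
Local Open Scope ring_scope.

(** * Frobenius norm *)

Section Frobenius.
Context {R : realType} {m n : nat}.
Implicit Types (A B C : 'M[R]_(m, n)) (a : R).

Definition dot A B : R := \tr (A *m B^T).

Lemma dotC A B : dot A B = dot B A.
Proof. by rewrite /dot -mxtrace_tr trmx_mul trmxK. Qed.

Lemma dotDl A B C : dot (A + B) C = dot A C + dot B C.
Proof. by rewrite /dot mulmxDl mxtraceD. Qed.

Lemma dotZl a A B : dot (a *: A) B = a * dot A B.
Proof. by rewrite /dot -scalemxAl mxtraceZ. Qed.

Lemma dotNl A B : dot (- A) B = - dot A B.
Proof. by rewrite -scaleN1r dotZl mulN1r. Qed.

Lemma dotDr A B C : dot A (B + C) = dot A B + dot A C.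
Proof. by rewrite dotC dotDl !(dotC A). Qed.

Lemma dotZr a A B : dot A (a *: B) = a * dot A B.
Proof. by rewrite dotC dotZl (dotC A). Qed.

Lemma dotNr A B : dot A (- B) = - dot A B.
Proof. by rewrite dotC dotNl (dotC A). Qed.

Lemma dot0r A : dot A 0 = 0.
Proof. by rewrite -(scale0r (0 : 'M[R]_(m, n))) dotZr mul0r. Qed.

Definition dotE := (dotDl, dotDr, dotNl, dotNr, dotZl, dotZr).

Lemma dotAA A : dot A A = \sum_(i < m) \sum_(j < n) A i j ^+ 2.
Proof.
apply: eq_bigr => i _; rewrite mxE; apply: eq_bigr => j _.
by rewrite mxE expr2.
Qed.

Lemma dot_ge0 A : 0 <= dot A A.
Proof.
by rewrite dotAA; do 2!apply: sumr_ge0 => ? _; exact: sqr_ge0.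
Qed.

Lemma frobE A : frob A = Num.sqrt (dot A A).
Proof. by rewrite /frob dotAA. Qed.

Lemma sqr_frob A : frob A ^+ 2 = dot A A.
Proof. by rewrite frobE sqr_sqrtr ?dot_ge0. Qed.

Lemma frob_ge0 A : 0 <= frob A.
Proof. exact: sqrtr_ge0. Qed.

Lemma frobN A : frob (- A) = frob A.
Proof. by rewrite !frobE !dotE opprK. Qed.

Lemma frobBC A B : frob (A - B) = frob (B - A).
Proof. by rewrite -frobN opprB. Qed.

Lemma frobZ a A : frob (a *: A) = `|a| * frob A.
Proof.
by rewrite !frobE !dotE mulrA -expr2 sqrtrM ?sqr_ge0// sqrtr_sqr.
Qed.

Lemma frob0 : frob (0 : 'M[R]_(m, n)) = 0.
Proof. by rewrite -(scale0r 0) frobZ normr0 mul0r. Qed.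

Lemma coord_le_frob A i j : `|A i j| <= frob A.
Proof.
rewrite -(sqrtr_sqr (A i j)) frobE ler_sqrt ?dot_ge0// dotAA.
rewrite (bigD1 i)//= (bigD1 j)//= -addrA lerDl addr_ge0//.
  by apply: sumr_ge0 => ? _; exact: sqr_ge0.
by do 2!apply: sumr_ge0 => ? _; exact: sqr_ge0.
Qed.

Lemma frob_eq0 A : (frob A == 0) = (A == 0).
Proof.
apply/eqP/eqP => [A0|->]; last exact: frob0.
apply/matrixP => i j; rewrite mxE; apply/eqP.
by rewrite -normr_eq0 eq_le normr_ge0 andbT -A0 coord_le_frob.
Qed.

Lemma frob_gt0 A : (0 < frob A) = (A != 0).
Proof. by rewrite lt_def frob_ge0 andbT frob_eq0. Qed.

Lemma normr_le_frob A : `|A| <= frob A.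
Proof.
rewrite [ `|A| ]/Num.norm/= mx_normrE; apply/bigmax_leP; split=> [|ij _].
  exact: frob_ge0.
exact: coord_le_frob.
Qed.

(** Cauchy-Schwarz: the squared norm of [dot B B *: A - dot A B *: B] is [dot B B] times the
    difference of the two sides. *)
Lemma sqr_dot_le A B : dot A B ^+ 2 <= dot A A * dot B B.
Proof.
have [->|B0] := eqVneq B 0; first by rewrite -(scale0r 0) !dotE; lra.
have b0 : 0 < dot B B by rewrite -sqr_frob exprn_gt0// frob_gt0.
rewrite -subr_ge0 -(pmulr_rge0 _ b0).
have := dot_ge0 (dot B B *: A - dot A B *: B).
by rewrite !dotE (dotC B A); lra.
Qed.

Lemma dot_le A B : dot A B <= frob A * frob B.
Proof.
apply: le_trans (ler_norm _) _.
rewrite -sqrtr_sqr !frobE -sqrtrM ?dot_ge0//.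
by rewrite ler_sqrt ?mulr_ge0 ?dot_ge0// sqr_dot_le.
Qed.

Lemma sqr_frobD A B :
  frob (A + B) ^+ 2 = frob A ^+ 2 + 2 * dot A B + frob B ^+ 2.
Proof. by rewrite !sqr_frob !dotE (dotC B A); ring. Qed.

Lemma sqr_frobB A B :
  frob (A - B) ^+ 2 = frob A ^+ 2 - 2 * dot A B + frob B ^+ 2.
Proof. by rewrite sqr_frobD dotNr frobN mulrN. Qed.

Lemma sqr_frobZ a A : frob (a *: A) ^+ 2 = a ^+ 2 * frob A ^+ 2.
Proof. by rewrite frobZ exprMn real_normK ?num_real. Qed.

Lemma frobD A B : frob (A + B) <= frob A + frob B.
Proof.
rewrite -(@ler_pXn2r _ 2)// ?nnegrE ?addr_ge0 ?frob_ge0//.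
rewrite sqr_frob sqrrD !sqr_frob !dotE (dotC B A).
have := dot_le A B; lra.
Qed.

Lemma frob_triangle B A C : frob (A - C) <= frob (A - B) + frob (B - C).
Proof. by rewrite (le_trans _ (frobD _ _))// addrA subrK. Qed.

Lemma frob_continuous : continuous (@frob R m n).
Proof.
move=> A; rewrite /frob.
apply: continuous_comp; last exact: sqrt_continuous.
move: A; apply: continuous_big => [x|i _ x]; first exact: add_continuous.
move: x; apply: continuous_big => [x|j _ x]; first exact: add_continuous.
exact: (continuous_comp (@coord_continuous _ _ _ i j x) (@exprn_continuous _ 2
  _)).
Qed.

Lemma frob_convex a A B C r : 0 <= a <= 1 ->
  frob (A - C) < r -> frob (B - C) < r ->
  frob ((1 - a) *: A + a *: B - C) < r.
Proof.
move=> /andP[a0 a1] Ar Br.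
have -> : (1 - a) *: A + a *: B - C = (1 - a) *: (A - C) + a *: (B - C).
  by rewrite !scalerBr !scalerBl !scale1r; apply/matrixP => i j; rewrite !mxE;
    ring.
apply: le_lt_trans (frobD _ _) _; rewrite !frobZ !ger0_norm; [|lra..].
have [->|a_gt0] := eqVneq a 0; first by lra.
have {a_gt0} : 0 < a by lra.
by nra.
Qed.

End Frobenius.

Lemma frob_le_normr (R : realType) m n :
  exists2 K : R, 0 < K & forall A : 'M[R]_(m, n), frob A <= K * `|A|.
Proof.
(* The summand 1 keeps the constant positive for matrices without entries. *)
exists (Num.sqrt ((m * n)%:R + 1)) => [|A].
  by rewrite sqrtr_gt0 ltr_wpDl.
rewrite frobE -[X in _ * X]ger0_norm// -sqrtr_sqr -sqrtrM ?addr_ge0//.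
rewrite ler_sqrt; last by rewrite mulr_ge0 ?addr_ge0 ?sqr_ge0.
rewrite dotAA (@le_trans _ _ (\sum_(i < m) \sum_(j < n) `|A| ^+ 2))//;
  last first.
  rewrite !sumr_const !card_ord -mulrnA -[_ *+ _]mulr_natl mulnC.
  by rewrite ler_wpM2r ?sqr_ge0// lerDl.
do 2!apply: ler_sum => ? _; rewrite -real_normK ?num_real//.
rewrite ler_pXn2r ?nnegrE//; rewrite [ `|A| ]/Num.norm/= mx_normrE.
exact: (le_bigmax _ (fun ij => `|A ij.1 ij.2|) (_, _)).
Qed.

Lemma cvg_frobP (R : realType) (T : topologicalType) m n (f : T -> 'M[R]_(m, n))
    (F : set_system T) (FF : Filter F) (A : 'M[R]_(m, n)) :
  f @ F --> A <-> forall e : R, 0 < e -> \forall x \near F, frob (f x - A) < e.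
Proof.
split=> [/cvgrPdist_lt fA e e0|fA].
  have [K K0 le_K] := frob_le_normr R m n.
  have := fA (e / K); rewrite divr_gt0// => /(_ isT); apply: filterS => x.
  rewrite ltr_pdivlMr// distrC mulrC; exact: le_lt_trans.
apply/cvgrPdist_lt => e /fA; apply: filterS => x.
by rewrite distrC; apply: le_lt_trans; exact: normr_le_frob.
Qed.

(** * Closest points and reach *)

Section ClosestPoint.
Context {R : realType} {m n : nat}.
Implicit Types (X : set 'M[R]_(m, n)) (x y z : 'M[R]_(m, n)) (r : R).

(** The condition inside [reach], but with the open thickening also at r = 0, so that it is vacuous
    for r <= 0. *)
Definition uniquely_closest X r := forall y x x',
  (exists2 z, X z & frob (y - z) < r) ->
  closest_point X y x -> closest_point X y x' -> x = x'.

Lemma thickeningE X r : 0 < r ->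
  thickening X r = [set y | exists2 x, X x & frob (y - x) < r].
Proof. by move=> r0; rewrite /thickening gt_eqF. Qed.

(** The supremum need not be attained: a point at distance less than r from X is at distance less
    than some admissible s. *)
Lemma reach_uniquely_closest X r :
  (r%:E <= reach X)%E -> uniquely_closest X r.
Proof.
move=> rX y x x' [z Xz yz]; have : ((frob (y - z))%:E < reach X)%E.
  by rewrite (lt_le_trans _ rX).
move=> /ereal_sup_gt[_ [s [s0 Xs] <-]]; rewrite lte_fin => yzs.
apply: (Xs y); rewrite thickeningE; first by exists z.
exact: le_lt_trans (frob_ge0 _) yzs.
Qed.

Lemma frob_sub_continuous y : continuous (fun x => frob (y - x)).
Proof.
move=> x; apply: (@continuous_comp _ _ _ (fun x => y - x) (@frob R m n));
  last exact: frob_continuous.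
by apply: continuousB; [exact: cst_continuous|exact: cvg_id].
Qed.

Lemma near_frob y (e : R) : 0 < e -> \forall z \near y, frob (z - y) < e.
Proof. by move=> e0; exact: ((@cvg_frobP R _ m n id (nbhs y) _ y).1 cvg_id e
  e0). Qed.

Lemma closest_point_exists X y : compact X -> X !=set0 -> exists x,
  closest_point X y x.
Proof.
move=> cX X0; have [|x Xx minx] := compact_EVT_min (f := fun x => frob (y - x))
  X0 cX.
  by apply: continuous_subspaceT; exact: frob_sub_continuous.
exists x; split; first exact/set_mem.
by move=> x' Xx'; exact/minx/mem_set.
Qed.

(** On the compact set K of points of X at distance at least e from x, the distance to y has a
    minimum above [frob (y - x)]. Moving y by less than half of this gap keeps its closest points
    out of K. *)
Lemma closest_point_stable X y x : compact X -> closest_point X y x ->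
  (forall x', closest_point X y x' -> x = x') ->
  forall e, 0 < e -> exists2 c, 0 < c & forall y' x', frob (y' - y) < c ->
    closest_point X y' x' -> frob (x' - x) < e.
Proof.
move=> cX [Xx yx] uniqx e e0.
pose K := X `&` [set x' | e <= frob (x - x')].
have [[x0 Kx0]|K0] := pselect (K !=set0); last first.
  exists 1 => // y' x' _ [Xx' _]; rewrite ltNge frobBC.
  by apply/negP => xx'; apply: K0; exists x'.
have cK : compact K.
  apply: compact_closedI => //.
  rewrite (_ : [set _ | _] = (fun x' => frob (x - x')) @^-1` [set s | e <=
    s])//.
  apply: closed_comp; last exact: closed_ge.
  by move=> x' _; exact: frob_sub_continuous.
have [x1 [[Xx1 /= xx1] minx1]] := @closest_point_exists K y cK (ex_intro _ _
  Kx0).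
have yx1 : frob (y - x) < frob (y - x1).
  rewrite lt_neqAle yx// andbT; apply/eqP => yxx1.
  have xE : x = x1 by apply: uniqx; split=> // x' /yx; rewrite yxx1.
  by move: xx1; rewrite xE subrr frob0 leNgt e0.
exists ((frob (y - x1) - frob (y - x)) / 2) => [|y' x' y'y [Xx' y'x']];
  first lra.
rewrite ltNge frobBC; apply/negP => xx'.
have := minx1 x' (conj Xx' xx'); have := y'x' x Xx.
have := frob_triangle y' y x'; have := frob_triangle y y' x.
move: y'y; rewrite (frobBC y'); lra.
Qed.

Definition proj X y := xget 0 (closest_point X y).

Lemma projP X y : compact X -> X !=set0 -> closest_point X y (proj X y).
Proof. by move=> cX X0; apply: xgetPex; exact: closest_point_exists. Qed.

Lemma proj_id X x : X x -> proj X x = x.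
Proof.
move=> Xx; have [] : closest_point X x (proj X x).
  by apply: xgetPex; exists x; split=> // *; rewrite subrr frob0 frob_ge0.
move=> _ /(_ x Xx); rewrite subrr frob0 => x0; apply/esym/eqP.
by rewrite -subr_eq0 -frob_eq0 eq_le x0 frob_ge0.
Qed.

Lemma proj_continuous X r : compact X -> uniquely_closest X r ->
  {within [set y | exists2 x, X x & frob (y - x) < r], continuous (proj X)}.
Proof.
move=> cX uX; apply/subspace_continuousP => y [x Xx yx].
have X0 : X !=set0 by exists x.
have PX z := projP z cX X0.
apply/cvg_frobP => e e0.
have [|c c0 cP] := closest_point_stable cX (PX y) _ e0.
  by move=> x' yx'; apply: uX (PX y) yx'; exists x.
rewrite near_withinE; apply: filterS (near_frob y c0) => z + _ => /cP; exact.
Qed.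

#[local] Opaque frob proj dot.

Lemma dist_proj_lipschitz X y z : compact X -> X !=set0 ->
  frob (y - proj X y) <= frob (y - z) + frob (z - proj X z).
Proof.
move=> cX X0; apply: le_trans (frob_triangle _ _ _).
by have [_] := projP y cX X0; apply; have [] := projP z cX X0.
Qed.

Lemma dist_proj_continuous X : compact X -> X !=set0 ->
  continuous (fun y => frob (y - proj X y)).
Proof.
move=> cX X0 y; apply/(@cvgrPdist_lt _ _ _ (nbhs y)) => e e0.
near=> z; apply: (@le_lt_trans _ _ (frob (z - y))); last by near: z;
  exact: near_frob.
have := dist_proj_lipschitz y z cX X0; have := dist_proj_lipschitz z y cX X0.
rewrite ler_norml (frobBC y z); move: (frob _) (frob _) (frob _) => a b c.
lra.
Unshelve. all: by end_near. Qed.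

End ClosestPoint.

(** * Federer's inequality *)

Section Federer.
#[local] Opaque frob proj dot.
Context {R : realType} {N : nat}.
Implicit Types (X : set 'rV[R]_N) (x y z u v w : 'rV[R]_N) (r s : R).

Lemma frob_ball_compact z r : compact [set w : 'rV[R]_N | frob (w - z) <= r].
Proof.
apply: bounded_closed_compact.
  exists (`|z| + r); split=> [|s rs w /= wz]; first exact: num_real.
  have := ler_normD (w - z) z; have := normr_le_frob (w - z); rewrite subrK.
  by move: rs wz; lra.
rewrite (_ : [set _ | _] = (fun w => frob (z - w)) @^-1` [set s | s <= r]).
  by apply: closed_comp; [move=> w _;
    exact: frob_sub_continuous|exact: closed_le].
by apply/seteqP; split=> w /=; rewrite frobBC.
Qed.

(* v is y moved away from its closest point. *)
Lemma dist_proj_slope X r y lam : compact X -> uniquely_closest X r ->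
  X !=set0 -> 0 < frob (y - proj X y) < r -> 0 <= lam < 1 ->
  forall e, 0 < e -> exists v, [/\ 0 < frob (v - y), frob (v - y) < e &
    frob (y - proj X y) + lam * frob (v - y) < frob (v - proj X v)].
Proof.
move=> cX uX X0 /andP[dy0 dyr] /andP[lam0 lam1] e e0.
have Px := projP y cX X0; move: Px dy0 dyr.
move: (proj X y) => x Px; have /= := erefl (frob (y - x)).
move: {-1}(frob (y - x)) => s sE s0 sr.
(* k is half of the slack 1 - lam: the closest point will move by less than k * s, which costs a
   factor 1 - k in the inner product below. *)
have [k k0 kE] : exists2 k, 0 < k & lam = 1 - 2 * k.
  by exists ((1 - lam) / 2); lra.
have [|c c0 cP] := closest_point_stable cX Px _ (mulr_gt0 k0 s0).
  move=> x' yx'; apply: (uX _ _ _ _ Px yx').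
  by exists x; rewrite ?sE//; have [] := Px.
have [t [t0 tc te ts]] : exists t, [/\ 0 < t, t < c, t < e & t <= s].
  exists (Num.min (c / 2) (Num.min (e / 2) s)).
  by rewrite !lt_min !gt_min !ge_min lexx !orbT; split=> //; lra.
have [v vy vE] : exists2 v, frob (v - y) = t & v - y = (t / s) *: (y - x).
  exists (y + (t / s) *: (y - x)); rewrite addrAC subrr add0r//.
  by rewrite frobZ ger0_norm ?divr_ge0 ?sE ?divfK ?gt_eqF// ltW.
exists v; rewrite vy; split=> [//|//|].
have := projP v cX X0; move: (proj X v) => x' Px'.
have xx' : frob (x' - x) < k * s by apply: cP Px'; rewrite vy.
have sx' : s <= frob (y - x').
  by rewrite -sE; case: Px => _; apply; case: Px'.
have dotxx' : s ^+ 2 - k * s ^+ 2 <= dot (y - x') (y - x).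
  have -> : y - x' = (y - x) - (x' - x) by rewrite opprB addrA subrK.
  rewrite dotDl dotNl -sqr_frob sE; have := dot_le (x' - x) (y - x).
  rewrite sE; move: (dot _ _) (frob _) xx' => p q xx' pq.
  have : q * s <= k * s * s by rewrite ler_wpM2r// ltW.
  by lra.
(* The left side exceeds (s + (1 - 2k) t)^2 by 2kts + 4k(1 - k) t^2. *)
have key : s ^+ 2 + 2 * t * (1 - k) * s + t ^+ 2 <= frob (v - x') ^+ 2.
  have -> : v - x' = (y - x') + (t / s) *: (y - x) by rewrite -vE [RHS]addrC
    addrA subrK.
  rewrite sqr_frobD dotZr sqr_frobZ sE.
  have -> : (t / s) ^+ 2 * s ^+ 2 = t ^+ 2 by field; rewrite gt_eqF.
  have : t / s * (s ^+ 2 - k * s ^+ 2) <= t / s * dot (y - x') (y - x).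
    by rewrite ler_pM2l ?divr_gt0.
  have -> : t / s * (s ^+ 2 - k * s ^+ 2) = t * (1 - k) * s by field;
    rewrite gt_eqF.
  have : s ^+ 2 <= frob (y - x') ^+ 2 by rewrite ler_pXn2r ?nnegrE ?frob_ge0//
    ltW.
  move: (dot _ _) (frob _ ^+ 2) => p q; lra.
rewrite -(@ltr_pXn2r _ 2)// ?nnegrE ?frob_ge0//; last first.
  by rewrite addr_ge0 ?mulr_ge0 ?(ltW s0) ?(ltW t0).
apply: lt_le_trans key; rewrite kE in lam0 *.
have : 0 < k * (t * s) by rewrite !mulr_gt0.
have : 0 <= k * (1 - k) * t ^+ 2 by rewrite !mulr_ge0 ?sqr_ge0//; lra.
by lra.
Qed.

(** For d = |y - x|, b = |w - y|^2 and a the inner product of w - y and y - x, the conclusion bounds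
    the squared norm of (w - y) - (q - 1)(y - x) by 0. It is q times the first inequality plus q - 1
    times the second. *)
Lemma triangle_equality_ineq (q d a b s : R) : q * d = s -> 1 <= q ->
  b <= (s - d) ^+ 2 -> s ^+ 2 <= b + 2 * a + d ^+ 2 ->
  b - 2 * ((q - 1) * a) + (q - 1) ^+ 2 * d ^+ 2 <= 0.
Proof.
move=> <- q1 e2 e1; have q0 : 0 <= q - 1 by lra.
have := ler_wpM2l q0 e1; have := ler_wpM2l (le_trans ler01 q1) e2; lra.
Qed.

(** Beyond y, the distance to X grows at unit speed along the ray from its projection. A point w at
    distance at least s from X is found in the closed ball of radius s - dist y about y by
    maximization; the equality case of the triangle inequality then puts w on the ray. *)
Lemma ray_dist_proj X r y s : compact X -> uniquely_closest X r ->
  X !=set0 -> 0 < frob (y - proj X y) -> frob (y - proj X y) <= s < r ->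
  forall x', X x' ->
  s <= frob (proj X y + (s / frob (y - proj X y)) *: (y - proj X y) - x').
Proof.
move=> cX uX X0 + /andP[]; have cdist := dist_proj_continuous cX X0.
have [dist distE] : exists dist, forall w, frob (w - proj X w) = dist w.
  by exists (fun w => frob (w - proj X w)).
have {cdist} : continuous dist by rewrite -(funext distE).
rewrite distE => cdist d0 ds sr.
pose B := [set w : 'rV[R]_N | frob (w - y) <= s - dist y].
have By : B y by rewrite /B/= subrr frob0 subr_ge0.
have cB : compact B by exact: frob_ball_compact.
(* By the slope lemma, a maximum point of dist w - lam * frob (y - w) cannot be
   interior to B. *)
have far lam : 0 <= lam < 1 ->
    exists2 w, B w & dist y + lam * (s - dist y) <= dist w.
  move=> /andP[lam0 lam1].
  have [||w /set_mem Bw maxw] := @compact_EVT_max _ _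
      (fun w => dist w - lam * frob (y - w)) B _ cB; first by exists y.
    apply: continuous_subspaceT => w.
    apply: (@continuousB _ _ _ dist (fun w => lam * frob (y - w)));
      first exact: cdist.
    by apply: continuousM; [exact: cst_continuous|exact: frob_sub_continuous].
  exists w; first by [].
  have := maxw y (mem_set By); rewrite subrr frob0 mulr0 subr0 => ydw.
  have [wy|wy] := ltP (frob (w - y)) (s - dist y); last first.
    move: ydw; rewrite frobBC lerBrDr; apply: le_trans.
    by rewrite lerD2l ler_wpM2l.
  have w0 : 0 < dist w.
    apply: lt_le_trans d0 (le_trans ydw _).
    by rewrite gerBl mulr_ge0// frob_ge0.
  have wr : dist w < r.
    have := dist_proj_lipschitz w y cX X0; rewrite !distE => /le_lt_trans;
      apply.
    by rewrite (lt_trans _ sr)// -ltrBrDr.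
  (* A slope strictly between lam and 1 yields a point v of B that strictly beats the maximum. *)
  have lam'1 : 0 <= (1 + lam) / 2 < 1 by clear -lam0 lam1; lra.
  have := dist_proj_slope cX uX X0 _ lam'1.
  move=> /(_ w); rewrite distE w0 wr => /(_ isT (s - dist y - frob (w - y))).
  rewrite subr_gt0 => /(_ wy)[v [vw0 vw]].
  rewrite !distE => /ltW vd.
  have Bv : B v.
    by rewrite /B/= (le_trans (frob_triangle w v y))// -lerBrDr ltW.
  have := maxw v (mem_set Bv); move: vd.
  have := frob_triangle w y v; rewrite (frobBC w v).
  clear -vw0 lam0 lam1; move: (dist v) (dist w) (frob (v - w)) (frob (y - v))
    (frob (y - w)) vw0.
  move=> dv dw c a b c0 abc vd maxv.
  have : lam * a <= lam * (b + c) by rewrite ler_wpM2l.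
  have : lam * c < (1 + lam) / 2 * c by rewrite ltr_pM2r//; lra.
  by lra.
have [||w /set_mem Bw maxw] := @compact_EVT_max _ _ dist B _ cB;
  first by exists y.
  exact: continuous_subspaceT.
have sw : s <= dist w.
  have [//|ws] := leP s (dist w).
  have yw : dist y <= dist w by exact: maxw (mem_set By).
  have far' lam : 0 <= lam < 1 -> dist y + lam * (s - dist y) <= dist w.
    by move=> /far[v /mem_set/maxw vw /le_trans]; exact.
  clear -ws yw far'; move: (dist y) (dist w) ws yw far' => a b ws yw far'.
  have eta0 : 0 < s - a by lra.
  (* q is the slope that the maximum b realizes; the slope (q + 1) / 2 is larger and still below 1,
     against [far']. *)
  have [q [qE q0 q1]] : exists q, [/\ q * (s - a) = b - a, 0 <= q & q < 1].
    exists ((b - a) / (s - a)); rewrite divfK ?gt_eqF// ltr_pdivrMr// mul1r.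
    by rewrite divr_ge0 ?(ltW eta0) ?subr_ge0//; split=> //; lra.
  have /far' : 0 <= (q + 1) / 2 < 1 by lra.
  by clear far'; nra.
have [Xx _] := projP y cX X0.
have Pw x' : X x' -> s <= frob (w - x').
  move=> Xx'; apply: le_trans sw _; rewrite -distE.
  by have [_] := projP w cX X0; exact.
suff -> : proj X y + (s / dist y) *: (y - proj X y) = w by [].
(* equality case of the triangle inequality *)
apply/esym/eqP; rewrite -subr_eq0 -frob_eq0 eq_le frob_ge0 andbT.
rewrite -(@ler_pXn2r _ 2)// ?nnegrE ?frob_ge0// expr0n/=.
have -> : w - (proj X y + (s / dist y) *: (y - proj X y)) =
    (w - y) - (s / dist y - 1) *: (y - proj X y).
  by rewrite scalerBl scale1r !opprB !opprD !addrA subrK addrAC.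
have s0 : 0 <= s by rewrite (le_trans _ ds)// ltW.
have : s ^+ 2 <= frob (w - proj X y) ^+ 2.
  by rewrite ler_pXn2r ?nnegrE ?frob_ge0//; exact: Pw.
have -> : w - proj X y = (w - y) + (y - proj X y) by rewrite addrA subrK.
rewrite (sqr_frobD (w - y) (y - proj X y)) (sqr_frobB (w - y)) dotZr sqr_frobZ
  distE.
have : frob (w - y) ^+ 2 <= (s - dist y) ^+ 2.
  by rewrite ler_pXn2r ?nnegrE ?frob_ge0//; exact: le_trans (frob_ge0 _) Bw.
have sE : s / dist y * dist y = s by rewrite divfK// gt_eqF.
have q1 : 1 <= s / dist y by rewrite ler_pdivlMr// mul1r.
move: (frob _ ^+ 2) sE q1 => b sE q1.
pose q : R := s / dist y; pose a : R := dot (w - y) (y - proj X y).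
move=> e2 e1; exact: (triangle_equality_ineq (q := q) (d := dist y) (a := a) sE
  q1 e2 e1).
Qed.

(* Federer: the open ball of radius r tangent to X at proj X y, with center in
   the direction of y, does not meet X. *)
Lemma tangent_ball_disjoint X r y x' : compact X -> uniquely_closest X r ->
  frob (y - proj X y) < r -> X x' ->
  2 * r * dot (x' - proj X y) (y - proj X y) <=
    frob (x' - proj X y) ^+ 2 * frob (y - proj X y).
Proof.
move=> cX uX; have [->|] := eqVneq (y - proj X y) 0.
  by rewrite frob0 dot0r !mulr0.
rewrite -frob_gt0 => d0 dr Xx'; have X0 : X !=set0 by exists x'.
have := ray_dist_proj cX uX X0 d0; move: d0 dr.
move: (proj X y) => x; move eqd : (frob (y - x)) => d d0 dr ray.
rewrite leNgt; apply/negP; move eqp : (dot _ _) => p.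
have := sqr_ge0 (frob (x' - x)); move eqq : (frob _ ^+ 2) => q q0 qp.
have p0 : 0 < p.
  rewrite ltNge; apply/negP => p0; move: qp; rewrite ltNge => /negP; apply.
  apply: le_trans (mulr_ge0 q0 (ltW d0)).
  by rewrite pmulr_rle0// mulr_gt0// (lt_trans d0).
(* Past q * d / (2 * p), the point of the ray at distance s from x is closer to x' than to x. If the
   inequality fails, this value lies below r, which leaves room for an s' contradicting [ray]. *)
pose s := Num.max d (q * d / (2 * p)).
have ds : d <= s by rewrite le_max lexx.
have sr : s < r.
  by rewrite gt_max dr/= ltr_pdivrMr ?mulr_gt0//; lra.
have sq : q * d <= 2 * s * p.
  have : q * d / (2 * p) <= s by rewrite le_max lexx orbT.
  by rewrite ler_pdivrMr ?mulr_gt0//; lra.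
have [s' ss' s'r] : exists2 s', s < s' & s' < r by exists ((s + r) / 2); lra.
have s'0 : 0 <= s' by rewrite (le_trans (ltW d0))// (le_trans ds)// ltW.
have /ray/(_ _ Xx') : d <= s' < r by rewrite s'r (le_trans ds)// ltW.
rewrite -(@ler_pXn2r _ 2)// ?nnegrE ?frob_ge0//.
rewrite (addrC x) -addrA -(opprB x' x) sqr_frobB dotZl dotC sqr_frobZ eqd eqp
  eqq.
have : s' / d * d = s' by rewrite divfK// gt_eqF.
move: (s' / d) => k kd; rewrite -exprMn kd => kp.
have : k * p * 2 * d <= q * d by rewrite ler_pM2r//; lra.
have -> : k * p * 2 * d = 2 * s' * p by rewrite -kd; ring.
apply/negP; rewrite -ltNge (le_lt_trans sq)// ltr_pM2r//; lra.
Qed.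

End Federer.

(** * The Grassmannian *)

Section MatrixTopology.
Context {R : realType}.

(** Cauchy-Schwarz applied to each entry, the inner product of a row of A and a row of [B^T]. *)
Lemma sqr_frob_mul m n p (A : 'M[R]_(m, n)) (B : 'M[R]_(n, p)) :
  frob (A *m B) ^+ 2 <= frob A ^+ 2 * frob B ^+ 2.
Proof.
have BT : dot B B = dot B^T B^T by rewrite /dot trmxK mxtrace_mulC.
rewrite !sqr_frob BT !dotAA mulr_suml; apply: ler_sum => i _.
rewrite mulr_sumr; apply: ler_sum => j _.
have -> : (A *m B) i j = dot (row i A) (row j B^T).
  rewrite /dot /mxtrace big_ord1 !mxE; apply: eq_bigr => k _.
  by rewrite !mxE.
apply: le_trans (sqr_dot_le _ _) _; rewrite !dotAA !big_ord1.
by under [X in X * _]eq_bigr do rewrite mxE;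
  under [X in _ * X]eq_bigr do rewrite mxE.
Qed.

Lemma frob_vec_mx m n (v : 'rV[R]_(m * n)) : frob (vec_mx v) = frob v.
Proof.
rewrite !frobE !dotAA big_ord1 pair_big/=; congr Num.sqrt.
rewrite [RHS](reindex _ (curry_mxvec_bij _ _))/=.
by apply: eq_bigr => -[i j] _; rewrite mxE.
Qed.

(** Heine-Borel, transported from row vectors along the isometry [vec_mx]. *)
Lemma mx_bounded_closed_compact m n (X : set 'M[R]_(m, n)) (K : R) :
  (forall A, X A -> frob A <= K) -> closed X -> compact X.
Proof.
move=> XK cX.
have cvec : continuous (@vec_mx R m n).
  move=> v; apply/(@cvg_frobP R _ _ _ _ (nbhs v)) => e e0.
  have := near_frob v e0; apply: filterS => w.
  by rewrite -linearB/= frob_vec_mx.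
have -> : X = (@vec_mx R m n) @` ((@vec_mx R m n) @^-1` X).
  rewrite image_preimage//; apply/seteqP; split=> // A _.
  by exists (mxvec A) => //; exact: mxvecK.
apply: continuous_compact; first exact: continuous_subspaceT.
apply: bounded_closed_compact.
  exists K; split=> [|s Ks v /= /XK]; first exact: num_real.
  rewrite frob_vec_mx => vK; apply: le_trans (normr_le_frob v) (le_trans vK _).
  exact: ltW.
by apply: closed_comp => // v _; exact: cvec.
Qed.

Lemma closed_level m n (h : 'M[R]_(m, n) -> R) (c : R) :
  continuous h -> closed [set A | h A = c].
Proof.
move=> ch; rewrite (_ : [set _ | _] = h @^-1` [set c])//.
by apply: closed_comp; [move=> A _; exact: ch|exact: closed_eq].
Qed.

End MatrixTopology.

#[local] Opaque frob proj.

Section Grassmannian.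
Context {R : realType} {d n : nat}.
Implicit Types (A P Q : 'M[R]_n) (u v w : 'cV[R]_n).

(** In a full-rank factorization A = CB, idempotence forces BC = 1, and the trace of CB is that of
    BC. *)
Lemma mxtrace_idem (F : fieldType) (A : 'M[F]_n) :
  A = A *m A -> \tr A = (\rank A)%:R.
Proof.
move=> AA; have := mulmx_base A; have := row_base_free A;
  have := col_base_full A.
move: (col_base A) (row_base A) => C B Cfull Bfree CB.
have BC : B *m C = 1%:M.
  apply: (row_free_inj Bfree); apply: (row_full_inj Cfull).
  by rewrite /= mul1mx !mulmxA CB -mulmxA CB -AA.
by rewrite -[in LHS]CB mxtrace_mulC BC mxtrace1.
Qed.

(** With the trace in place of the rank, all conditions are polynomial equations, hence closed. *)
Lemma GrP A : Gr d n A <-> [/\ A = A^T, A = A *m A & \tr A = d%:R].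
Proof.
split=> -[sA AA rA]; split=> //; first by rewrite mxtrace_idem// rA.
by apply/eqP; rewrite -(eqr_nat R) -mxtrace_idem// rA.
Qed.

Lemma sqr_frob_Gr P : Gr d n P -> frob P ^+ 2 = d%:R.
Proof. by case/GrP => sP PP trP; rewrite sqr_frob /dot -sP -PP. Qed.

Lemma Gr_compact : compact (@Gr R d n).
Proof.
apply: (@mx_bounded_closed_compact _ _ _ _ (Num.sqrt d%:R)).
  move=> P /sqr_frob_Gr <-; rewrite sqrtr_sqr; exact: ler_norm.
have -> : Gr d n = (\bigcap_i \bigcap_j [set A : 'M[R]_n | A i j - A j i = 0])
    `&` (\bigcap_i \bigcap_j [set A : 'M[R]_n | A i j - \sum_k A i k * A k j =
      0])
    `&` [set A : 'M[R]_n | \sum_i A i i = d%:R].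
  apply/seteqP; split=> A.
    case/GrP=> sA AA trA; split=> //; split=> i _ j _ /=; apply/eqP;
      rewrite subr_eq0.
      by rewrite {1}sA mxE.
    by rewrite {1}AA mxE.
  case=> -[sA AA] trA; apply/GrP; split=> //; apply/matrixP => i j; apply/eqP;
    rewrite -subr_eq0.
    by rewrite mxE; apply/eqP; exact: sA.
  by rewrite mxE; apply/eqP; exact: AA.
have cM i j : continuous (fun A : 'M[R]_n => A i j) by exact: coord_continuous.
apply: closedI; first apply: closedI.
- do 2![apply: closed_bigI => ? _]; apply: closed_level => A.
  by apply: continuousB; exact: cM.
- do 2![apply: closed_bigI => ? _]; apply: closed_level => A.
  apply: continuousB; first exact: cM.
  move: A; apply: continuous_big => [x|k _ A]; first exact: add_continuous.
  by apply: continuousM; exact: cM.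
- apply: closed_level; apply: continuous_big => [x|k _ A];
  first exact: add_continuous.
  exact: cM.
Qed.

Lemma mul_tr_col u v : u^T *m v = (dot u v)%:M.
Proof.
rewrite [LHS]mx11_scalar; congr (_%:M).
by rewrite dotC /dot mxtrace_mulC /mxtrace big_ord1.
Qed.

(** Removing the line of u from the range of P leaves a projection E that kills v, because
    [P *m v = u]; adding the projection onto the line of v restores the rank. This gives curves in
    the Grassmannian through P. *)
Lemma Gr_replace_line P u v : Gr d n P -> P *m u = u -> P *m v = u ->
  u != 0 -> v != 0 ->
  Gr d n (P - (dot u u)^-1 *: (u *m u^T) + (dot v v)^-1 *: (v *m v^T)).
Proof.
move=> /GrP[sP PP trP] Pu Pv u0 v0; apply/GrP.
have uu : dot u u != 0 by rewrite -sqr_frob expf_eq0/= frob_eq0.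
have vv : dot v v != 0 by rewrite -sqr_frob expf_eq0/= frob_eq0.
have uP : u^T *m P = u^T by rewrite {1}sP -trmx_mul Pu.
have vP : v^T *m P = u^T by rewrite {1}sP -trmx_mul Pv.
have uv : dot u v = dot u u.
  have : u^T *m v = u^T *m u by rewrite -{1}uP -mulmxA Pv.
  by move/(congr1 mxtrace); rewrite !mul_tr_col !mxtrace_scalar.
set a := (dot u u)^-1; set b := (dot v v)^-1.
have au : a * dot u u = 1 by rewrite mulVf.
have bv : b * dot v v = 1 by rewrite mulVf.
split.
- rewrite linearD linearB/= !linearZ/= !trmx_mul !trmxK -sP//.
- pose E := P - a *: (u *m u^T).
  have Ev : E *m v = 0.
    rewrite mulmxBl Pv -scalemxAl -mulmxA mul_tr_col uv mul_mx_scalar scalerA.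
    by rewrite au scale1r subrr.
  have vE : v^T *m E = 0.
    rewrite mulmxBr vP -scalemxAr mulmxA mul_tr_col dotC uv mul_scalar_mx
      scalerA.
    by rewrite au scale1r subrr.
  have Eu : E *m u = 0.
    rewrite mulmxBl Pu -scalemxAl -mulmxA mul_tr_col mul_mx_scalar scalerA.
    by rewrite au scale1r subrr.
  have EP : E *m P = E.
    by rewrite mulmxBl -PP -scalemxAl -mulmxA uP.
  have EE : E *m E = E.
    by rewrite {2}/E mulmxBr EP -scalemxAr mulmxA Eu mul0mx scaler0 subr0.
  rewrite -/E; clearbody E.
  rewrite mulmxDl !mulmxDr EE -!scalemxAr -!scalemxAl mulmxA Ev mul0mx.
  rewrite scaler0 addr0 -[v *m v^T *m E]mulmxA vE mulmx0 scaler0 add0r.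
  rewrite -[v *m v^T *m _]mulmxA [v^T *m (v *m v^T)]mulmxA mul_tr_col.
  by rewrite mul_scalar_mx -scalemxAr !scalerA -mulrA bv mulr1.
- rewrite mxtraceD linearB/= !mxtraceZ trP (mxtrace_mulC u) (mxtrace_mulC v).
  rewrite !mul_tr_col !mxtrace_scalar !mulr1n.
  by rewrite au bv subrK.
Qed.

(** First-order condition at a minimum; it suffices to test t = a / (|b| + 1). *)
Lemma linear_le_quadratic_eq0 (a b : R) :
  (forall t, t * a <= t ^+ 2 * b) -> a = 0.
Proof.
move=> ab; apply/eqP; rewrite -sqrf_eq0 eq_le sqr_ge0 andbT.
have b1 : 0 < `|b| + 1 by rewrite ltr_wpDl.
have := ab (a / (`|b| + 1)); rewrite expr_div_n.
rewrite [X in X <= _]mulrAC -expr2 ler_pdivrMr//.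
have -> : a ^+ 2 / (`|b| + 1) ^+ 2 * b * (`|b| + 1) = a ^+ 2 * b / (`|b| + 1).
  by field; rewrite gt_eqF.
rewrite ler_pdivlMr// => h; have := ler_norm b; have := sqr_ge0 a.
by move: (a ^+ 2) h => q; nra.
Qed.

(** The line of u is rotated to that of u + t w. Since the norm is constant on the Grassmannian,
    minimality compares only inner products with A; once denominators are cleared, it bounds a
    linear term in t by a quadratic one. *)
Lemma closest_Gr_dot A P u w : closest_point (Gr d n) A P ->
  P *m u = u -> P *m w = 0 -> dot A (u *m w^T + w *m u^T) = 0.
Proof.
move=> [GP minP] Pu Pw; have [->|u0] := eqVneq u 0.
  by rewrite mul0mx trmx0 mulmx0 addr0 dot0r.
have uu : 0 < dot u u by rewrite -sqr_frob exprn_gt0// frob_gt0.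
have uw : dot u w = 0.
  have [sP _ _] := (GrP P).1 GP.
  by rewrite dotC -Pu /dot trmx_mul -sP mulmxA mxtrace_mulC mulmxA Pw mul0mx
    linear0.
suff /linear_le_quadratic_eq0/eqP : forall t,
    t * (dot u u * dot A (u *m w^T + w *m u^T)) <=
    t ^+ 2 * (dot A (u *m u^T) * dot w w - dot u u * dot A (w *m w^T)).
  by rewrite mulf_eq0 gt_eqF//= => /eqP.
move=> t; pose v := u + t *: w.
have vv : dot v v = dot u u + t ^+ 2 * dot w w.
  by rewrite /v !dotE (dotC w) uw; ring.
have vv0 : 0 < dot v v.
  by rewrite vv ltr_wpDr// mulr_ge0 ?sqr_ge0 ?dot_ge0.
have v0 : v != 0.
  by apply: contraTneq vv0 => ->; rewrite dot0r ltxx.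
have Pv : P *m v = u by rewrite mulmxDr -scalemxAr Pu Pw scaler0 addr0.
have GP' := Gr_replace_line GP Pu Pv u0 v0.
set P' := P - _ + _ in GP'.
have : frob (A - P) ^+ 2 <= frob (A - P') ^+ 2.
  by rewrite ler_pXn2r ?nnegrE ?frob_ge0//; exact: minP.
have -> : frob (A - P') ^+ 2 = frob A ^+ 2 - 2 * dot A P + 2 * (dot A (u *m
  u^T) /
    dot u u) - 2 * (dot A (v *m v^T) / dot v v) + d%:R.
  rewrite sqr_frobB (sqr_frob_Gr GP') dotDr dotDr dotNr !(dotZr _ A).
  by clearbody v; ring.
have -> : dot A (v *m v^T) = dot A (u *m u^T) +
    t * dot A (u *m w^T + w *m u^T) + t ^+ 2 * dot A (w *m w^T).
  rewrite /v linearD linearZ/= mulmxDl !mulmxDr -!scalemxAl -!scalemxAr !dotE.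
  by ring.
rewrite sqr_frobB (sqr_frob_Gr GP).
move: (dot A (u *m u^T)) (dot A (_ + _)) (dot A (w *m w^T)) (dot A P) => q s p
  x h.
have {}h : (q + t * s + t ^+ 2 * p) / dot v v <= q / dot u u.
  by move: h; move: (_ / dot v v) (q / _) => a b; lra.
move: h; rewrite ler_pdivrMr// => h.
have {h} : (q + t * s + t ^+ 2 * p) * dot u u <= q * dot v v.
  by rewrite -ler_pdivlMr// [leRHS]mulrAC.
rewrite vv; move: (dot u u) (dot w w) => a b.
lra.
Qed.

(** The matrices paired with A are tangent vectors at P. By linearity M may be an elementary matrix,
    and then the vector is u w^T + w u^T with u = P e_i and w = (1 - P) e_j. *)
Lemma closest_Gr_tangent A P M : closest_point (Gr d n) A P ->
  dot A (P *m M *m (1%:M - P) + (1%:M - P) *m M^T *m P) = 0.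
Proof.
move=> cP; have [/GrP[sP PP _] _] := cP.
rewrite [M]matrix_sum_delta.
have tr_sum m' n' (I : finType) (F : I -> 'M[R]_(m', n')) :
  (\sum_i F i)^T = \sum_i (F i)^T by exact: linear_sum.
have dot_sum (I : finType) (F : I -> 'M[R]_n) :
    dot A (\sum_i F i) = \sum_i dot A (F i).
  by rewrite /dot tr_sum mulmx_sumr linear_sum.
rewrite tr_sum !(mulmx_sumr, mulmx_suml) -big_split dot_sum big1// => i _.
rewrite tr_sum !(mulmx_sumr, mulmx_suml) -big_split dot_sum big1// => j _.
pose u := P *m delta_mx i (0 : 'I_1);
  pose w := (1%:M - P) *m delta_mx j (0 : 'I_1).
have s1P : (1%:M - P)^T = 1%:M - P by rewrite linearB/= trmx1 -sP.
have := @closest_Gr_dot A P u w cP.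
rewrite /u /w !mulmxA -PP mulmxBr mulmx1 -PP subrr mul0mx => /(_ erefl erefl).
rewrite !trmx_mul s1P -sP !trmx_delta !mulmxA => uw.
have -> : (M i j *: delta_mx i j)^T = M i j *: delta_mx j i.
  by rewrite linearZ/= trmx_delta.
rewrite /= -!(scalemxAr, scalemxAl) -scalerDr dotZr.
rewrite -(mul_delta_mx (0 : 'I_1)) -[delta_mx j i](mul_delta_mx (0 : 'I_1)).
by rewrite !mulmxA uw mulr0.
Qed.

(** Submultiplicativity of the norm, as the trace of [B^T *m B] is the squared norm of B. *)
Lemma sqr_frob_gram p (B : 'M[R]_(p, n)) : frob (B^T *m B) ^+ 2 <= \tr (B^T *m
  B) ^+ 2.
Proof.
apply: le_trans (sqr_frob_mul _ _) _; rewrite !sqr_frob expr2.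
by rewrite /dot trmxK (mxtrace_mulC B).
Qed.

(* The subtracted term is the tangent part of Q - P at P. *)
Lemma Gr_normal_part P Q : Gr d n P -> Gr d n Q ->
  2 * frob ((Q - P) - (P *m Q *m (1%:M - P) + (1%:M - P) *m Q *m P)) ^+ 2
    <= (frob (Q - P) ^+ 2) ^+ 2.
Proof.
move=> GP GQ; have [sP PP trP] := (GrP P).1 GP;
  have [sQ QQ trQ] := (GrP Q).1 GQ.
(* The normal part is the difference of the Gram matrices of C and B. They are orthogonal to each
   other, and each has trace d - tr(PQ), half of |Q - P|^2. *)
pose B := (1%:M - Q) *m P; pose C := Q *m (1%:M - P).
have s1P : (1%:M - P)^T = 1%:M - P by rewrite linearB/= trmx1 -sP.
have s1Q : (1%:M - Q)^T = 1%:M - Q by rewrite linearB/= trmx1 -sQ.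
have QQ1 : (1%:M - Q) *m (1%:M - Q) = 1%:M - Q.
  by rewrite mulmxBr mulmx1 mulmxBl mul1mx -QQ subrr subr0.
have BB : B^T *m B = P - P *m Q *m P.
  rewrite /B trmx_mul -sP s1Q mulmxA -(mulmxA P _ (1%:M - Q)) QQ1.
  by rewrite mulmxBr mulmx1 mulmxBl -PP.
have CC : C^T *m C = Q - P *m Q - Q *m P + P *m Q *m P.
  rewrite /C trmx_mul -sQ s1P mulmxA -(mulmxA (1%:M - P) Q Q) -QQ.
  by rewrite mulmxBl mul1mx mulmxBr mulmx1 mulmxBl opprB addrA addrAC.
have trB : \tr (B^T *m B) = d%:R - \tr (P *m Q).
  by rewrite BB linearB/= trP mxtrace_mulC mulmxA -PP.
have trC : \tr (C^T *m C) = d%:R - \tr (P *m Q).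
  rewrite CC linearD !linearB/= trQ (mxtrace_mulC Q P) (mxtrace_mulC _ P)
    mulmxA -PP.
  by rewrite subrK.
have BC : dot (C^T *m C) (B^T *m B) = 0.
  have CB : C *m B^T = 0.
    rewrite /C /B trmx_mul -sP mulmxA -(mulmxA Q) mulmxBl mul1mx -PP subrr.
    by rewrite mulmx0 mul0mx.
  by clearbody B C; rewrite /dot trmx_mul trmxK mulmxA -(mulmxA C^T) CB mulmx0
    mul0mx mxtrace0.
have -> : Q - P - (P *m Q *m (1%:M - P) + (1%:M - P) *m Q *m P) =
    C^T *m C - B^T *m B.
  rewrite BB CC mulmxBr mulmx1 !mulmxBl mul1mx.
  by apply/matrixP => i j; rewrite !mxE; ring.
rewrite (sqr_frobB (C^T *m C)) BC.
have -> : frob (Q - P) ^+ 2 = 2 * (d%:R - \tr (P *m Q)).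
  by rewrite sqr_frobB (sqr_frob_Gr GP) (sqr_frob_Gr GQ) dotC /dot -sQ; ring.
have := sqr_frob_gram B; have := sqr_frob_gram C; rewrite trB trC.
by move: (frob _ ^+ 2) (frob _ ^+ 2) (d%:R - _) => x y z; lra.
Qed.

(** For two closest points P and Q, equidistance gives |Q - P|^2 = 2<A - P, Q - P>, where only the
    normal part of Q - P contributes. So |Q - P|^2 <= sqrt 2 |A - P| |Q - P|^2, which forces Q = P
    when |A - P| < sqrt 2 / 2. *)
Lemma Gr_uniquely_closest : uniquely_closest (@Gr R d n) (Num.sqrt 2 / 2).
Proof.
move=> A P Q [Z GZ AZ] cP cQ; apply/eqP.
have [GP minP] := cP; have [GQ minQ] := cQ.
rewrite -subr_eq0 -oppr_eq0 opprB -frob_eq0 -sqrf_eq0.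
have [sP PP _] := (GrP P).1 GP; have [sQ _ _] := (GrP Q).1 GQ.
have AP : frob (A - P) < Num.sqrt 2 / 2 by exact: le_lt_trans (minP _ GZ) AZ.
have AQ : frob (A - Q) ^+ 2 = frob (A - P) ^+ 2.
  by congr (_ ^+ 2); apply/eqP; rewrite eq_le minP// minQ.
pose T := P *m Q *m (1%:M - P) + (1%:M - P) *m Q *m P.
have AT : dot A T = 0.
  by have := closest_Gr_tangent Q cP; rewrite -sQ.
have PT : dot P T = 0.
  rewrite dotC /dot -sP mulmxDl mxtraceD -!mulmxA mulmxBl mul1mx -PP subrr.
  rewrite !mulmx0 mxtrace0 add0r mxtrace_mulC -!mulmxA mulmxBr mulmx1 -PP subrr.
  by rewrite !mulmx0 mxtrace0.
have QPN : frob (Q - P) ^+ 2 = 2 * dot (A - P) (Q - P - T).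
  move: AQ; have -> : A - Q = (A - P) - (Q - P) by rewrite opprB addrA subrK.
  have APT : dot (A - P) T = 0.
    by clearbody T; rewrite dotDl dotNl AT PT subrr.
  rewrite (sqr_frobB (A - P)) [dot _ (_ - T)]dotDr dotNr APT; clear.
  by move: (dot _ _) (frob _ ^+ 2) (frob _ ^+ 2) => x y z; lra.
have := Gr_normal_part GP GQ; rewrite -/T.
have := dot_le (A - P) (Q - P - T); move: QPN.
have := frob_ge0 (A - P); have := frob_ge0 (Q - P - T).
have := sqr_ge0 (frob (Q - P)).
move: AP; move: (frob (A - P)) (frob (Q - P - T)) (frob _ ^+ 2) (dot _ _).
move=> a b q c aS + b0 a0 + cab => /[swap] -> c_ge0 bc.
have a2 : a ^+ 2 < 1 / 2.
  have -> : 1 / 2 = (Num.sqrt 2 / 2) ^+ 2 :> R.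
    by rewrite expr_div_n sqr_sqrtr//; field.
  by rewrite ltr_pXn2r ?nnegrE// divr_ge0// sqrtr_ge0.
have [c0|c0] := leP c 0; first by apply/eqP; lra.
have c2 : 0 < c ^+ 2 by rewrite exprn_gt0.
have : c ^+ 2 <= (a * b) ^+ 2 by rewrite ler_pXn2r ?nnegrE ?mulr_ge0// ltW.
have : a ^+ 2 * b ^+ 2 <= a ^+ 2 * (2 * c ^+ 2).
  by rewrite ler_wpM2l ?sqr_ge0//; lra.
have : a ^+ 2 * (2 * c ^+ 2) < 1 / 2 * (2 * c ^+ 2) by rewrite ltr_pM2r//; lra.
by rewrite exprMn; lra.
Qed.

End Grassmannian.

(** * Homotopies *)

Lemma within_comp (X Y Z : topologicalType) (A : set X) (B : set Y)
    (f : X -> Y) (g : Y -> Z) : set_fun A B f ->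
  {within A, continuous f} -> {within B, continuous g} ->
  {within A, continuous (g \o f)}.
Proof.
move=> AB /subspace_continuousP cf /subspace_continuousP cg.
apply/subspace_continuousP => x Ax W /(cg _ (AB _ Ax)) BW.
apply: (@filterS _ (nbhs x) _ _ _ _ (cf x Ax _ BW)) => y + Ay.
by move=> /(_ Ay)/(_ (AB _ Ay)).
Qed.

(** Pasting lemma: a point outside one of the closed pieces has a neighbourhood that misses it. *)
Lemma within_closedU (X Y : topologicalType) (A C1 C2 : set X) (f : X -> Y) :
  closed C1 -> closed C2 -> A `<=` C1 `|` C2 ->
  {within A `&` C1, continuous f} -> {within A `&` C2, continuous f} ->
  {within A, continuous f}.
Proof.
move=> cC1 cC2 AC cf1 cf2; apply/subspace_continuousP => x Ax W fW.
have near_piece C : closed C -> {within A `&` C, continuous f} ->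
    \forall y \near x, A y -> C y -> W (f y).
  move=> cC /subspace_continuousP cf; have [Cx|nCx] := pselect (C x).
    apply: (@filterS _ (nbhs x) _ _ _ _ (cf x (conj Ax Cx) _ fW)) => y + Ay Cy.
    exact.
  have := closed_openC cC; rewrite openE => /(_ x nCx).
  by apply: filterS => y nCy _ /nCy.
apply: (@filterS2 _ (nbhs x) _ _ _ _ _ (near_piece _ cC1 cf1) (near_piece _ cC2
  cf2)).
by move=> y W1 W2 Ay; have [/(W1 Ay)|/(W2 Ay)] := AC y Ay.
Qed.

Lemma continuous_pairing (T X Y : topologicalType) (f : T -> X) (g : T -> Y) :
  continuous f -> continuous g -> continuous (fun x => (f x, g x)).
Proof.
move=> cf cg x.
exact: (@cvg_pair _ _ _ (nbhs x) (nbhs (f x)) (nbhs (g x)) _ _ _ f g (cf x) (cg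
  x)).
Qed.

Lemma continuous_line (R : realType) (V : normedModType R) (T : topologicalType)
    (a : T -> R) (f g : T -> V) : continuous a -> continuous f -> continuous g
      ->
  continuous (fun x => (1 - a x) *: f x + a x *: g x).
Proof.
move=> ca cf cg x.
apply: (@continuousD _ _ _ (fun x => (1 - a x) *: f x) (fun x => a x *: g x)).
  apply: (@continuousZ _ _ _ (fun x => 1 - a x) f); last exact: cf.
  exact: (@continuousB R R^o T (fun=> 1) a x (@cst_continuous _ _ _ x) (ca x)).
exact: (@continuousZ _ _ _ a g x (ca x) (cg x)).
Qed.

Section HomotopyTheory.
Context {R : realType}.

Lemma within_snd (X Y : topologicalType) (A : set X) (f : X -> Y) :
  {within A, continuous f} ->
  {within (`[0, 1]%classic : set R) `*` A, continuous (f \o snd)}.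
Proof.
move=> cf; apply: (within_comp (B := A)) cf; first by move=> [t x] [].
by apply: continuous_subspaceT => x; exact: cvg_snd.
Qed.

Lemma within_fst (X : topologicalType) (A : set X) :
  {within (`[0, 1]%classic : set R) `*` A, continuous fst}.
Proof. by apply: continuous_subspaceT => x; exact: cvg_fst. Qed.

Lemma homotopic_postcomp (X Y Z : topologicalType) (A : set X) (B : set Y)
    (C : set Z) (k : Y -> Z) f0 f1 :
  set_fun B C k -> {within B, continuous k} ->
  homotopic R A B f0 f1 -> homotopic R A C (k \o f0) (k \o f1).
Proof.
move=> BC ck [H [cH HB H0 H1]]; exists (k \o H); split.
- exact: within_comp HB cH ck.
- by move=> tx /HB/BC.
- by move=> x Ax /=; rewrite H0.
- by move=> x Ax /=; rewrite H1.
Qed.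

Lemma homotopic_precomp (X Y Z : topologicalType) (A : set X) (B : set Y)
    (C : set Z) (u : X -> Y) f0 f1 :
  set_fun A B u -> {within A, continuous u} ->
  homotopic R B C f0 f1 -> homotopic R A C (f0 \o u) (f1 \o u).
Proof.
move=> AB cu [H [cH HC H0 H1]]; exists (H \o (fun tx => (tx.1, u tx.2))); split.
- apply: within_comp cH; first by move=> [t x] [/= t01 /AB ux].
  by apply: continuous_pairing; [exact: within_fst|exact: within_snd].
- by move=> [t x] [/= t01 /AB ux]; apply: HC.
- by move=> x Ax /=; rewrite H0//; exact: AB.
- by move=> x Ax /=; rewrite H1//; exact: AB.
Qed.

Lemma homotopic_refl (X Y : topologicalType) (A : set X) (B : set Y) f0 f1 :
  set_fun A B f0 -> {within A, continuous f0} ->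
  (forall x, A x -> f0 x = f1 x) -> homotopic R A B f0 f1.
Proof.
move=> AB cf0 f01; exists (f0 \o snd); split=> //; first exact: within_snd.
by move=> [t x] [_ /AB].
Qed.

Lemma homotopic_trans (X Y : topologicalType) (A : set X) (B : set Y) f0 f1 f2 :
  homotopic R A B f0 f1 -> homotopic R A B f1 f2 -> homotopic R A B f0 f2.
Proof.
move=> [H [cH HB H0 H1]] [K [cK KB K0 K1]].
pose D : set (R * X) := `[0, 1]%classic `*` A.
pose C1 : set (R * X) := fst @^-1` `[0, 2^-1]%classic.
pose C2 : set (R * X) := fst @^-1` `[2^-1, 1]%classic.
pose u1 (tx : R * X) : R * X := (2 * tx.1, tx.2).
pose u2 (tx : R * X) : R * X := (2 * tx.1 - 1, tx.2).
have cfst (x : R * X) : {for x, continuous fst} by exact: cvg_fst.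
have csnd (x : R * X) : {for x, continuous snd} by exact: cvg_snd.
have c2 (x : R * X) : {for x, continuous (fun tx : R * X => 2 * tx.1 : R)}.
  by apply: continuousM; [exact: cst_continuous|exact: cfst].
have cu1 : {within D `&` C1, continuous u1}.
  by apply/continuous_subspaceT/continuous_pairing; [exact: c2|exact: csnd].
have cu2 : {within D `&` C2, continuous u2}.
  apply/continuous_subspaceT/continuous_pairing; last exact: csnd.
  move=> x; apply: (@continuousB _ _ _ (fun tx : R * X => 2 * tx.1 : R) (fun=>
    1) x).
    exact: c2.
  exact: cst_continuous.
have D1 : set_fun (D `&` C1) D u1.
  by move=> [t x] [[/= _ Ax]]; rewrite /C1/= !in_itv/= => t01; split=> //=;
    rewrite in_itv/=; lra.
have D2 : set_fun (D `&` C2) D u2.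
  by move=> [t x] [[/= _ Ax]]; rewrite /C2/= !in_itv/= => t01; split=> //=;
    rewrite in_itv/=; lra.
exists (fun tx => if tx.1 <= 2^-1 then H (u1 tx) else K (u2 tx)); split.
- apply: (@within_closedU _ _ _ C1 C2).
  + apply: closed_comp; [by move=> x _; exact: cfst|exact: itv_closed].
  + apply: closed_comp; [by move=> x _; exact: cfst|exact: itv_closed].
  + move=> [t x] [/= + _]; rewrite /C1 /C2/= !in_itv/=.
    by case: (leP t 2^-1) => ? ?; [left|right]; lra.
  + apply: subspace_eq_continuous (within_comp D1 cu1 cH) => -[t x].
    by move=> /set_mem[_]; rewrite /C1/= in_itv/= => /andP[_ t2];
      rewrite /from_subspace/= t2.
  + apply: subspace_eq_continuous (within_comp D2 cu2 cK) => -[t x].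
    move=> /set_mem[[/= _ Ax]]; rewrite /C2/= in_itv/= => /andP[t2 _].
    rewrite /from_subspace/=; case: ifPn => // t2'; have -> : t = 2^-1 by lra.
    by rewrite /u1 /u2/= mulfV// subrr K0// H1.
- move=> [t x] tx; case: ifPn => [/= t2|]; [apply: HB;
  apply: D1|rewrite /= -ltNge => t2; apply: KB; apply: D2].
  + by split=> //; case: tx; rewrite /C1/= !in_itv/=; lra.
  + by split=> //; case: tx; rewrite /C2/= !in_itv/=; lra.
- by move=> x Ax /=; rewrite invr_ge0 ler0n /u1 mulr0 H0.
- move=> x Ax /=; rewrite ifN; last by lra.
  rewrite /u2/= (_ : 2 * 1 - 1 = 1) ?K1//; lra.
Qed.

Lemma homotopic_line (X : topologicalType) (A : set X) m n (B : set 'M[R]_(m,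
  n))
    (f0 f1 : X -> 'M[R]_(m, n)) :
  {within A, continuous f0} -> {within A, continuous f1} ->
  (forall t x, 0 <= t <= 1 -> A x -> B ((1 - t) *: f0 x + t *: f1 x)) ->
  homotopic R A B f0 f1.
Proof.
move=> cf0 cf1 ABf; exists (fun tx => (1 - tx.1) *: f0 tx.2 + tx.1 *: f1 tx.2).
split.
- by apply: continuous_line; [exact: within_fst|exact: within_snd|exact:
  within_snd].
- by move=> [t x] [/= t01 Ax]; apply: ABf; rewrite // in_itv in t01.
- by move=> x _ /=; rewrite subr0 scale1r scale0r addr0.
- by move=> x _ /=; rewrite subrr scale1r scale0r add0r.
Qed.

End HomotopyTheory.

(** * Thickenings and the Cech complex *)

Section Tubular.
Context {R : realType} {m n : nat}.
Implicit Types (X : set 'M[R]_(m, n)) (r : R).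

Lemma thickening_sub X r : 0 < r -> X `<=` thickening X r.
Proof. by move=> r0 x Xx; rewrite thickeningE//; exists x;
  rewrite // subrr frob0. Qed.

(** The segment from y to its projection stays in the ball of radius r about the projection. *)
Lemma inclusion_homotopy_equivalence X r : compact X -> 0 < r ->
  uniquely_closest X r -> homotopy_equivalence R X (thickening X r) idfun.
Proof.
move=> cX r0 uX; have cproj := proj_continuous cX uX.
have near_proj y : thickening X r y -> X (proj X y) /\ frob (y - proj X y) < r.
  rewrite thickeningE// => -[x Xx yx]; have X0 : X !=set0 by exists x.
  have [? minP] := projP y cX X0; split=> //; exact: le_lt_trans (minP x Xx) yx.
have cid (A : set 'M[R]_(m, n)) : {within A, continuous idfun}.
  by apply: continuous_subspaceT => x; exact: cvg_id.
rewrite -(thickeningE X r0) in cproj.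
split=> //; first exact: thickening_sub.
exists (proj X); split=> //; first by move=> y /near_proj[].
- apply: homotopic_refl => [x Xx||x Xx]; last exact: proj_id.
    by rewrite /= proj_id.
  apply: continuous_subspaceW cproj; exact: thickening_sub.
- apply: homotopic_line => // t y t01 /near_proj[Xy yr]; rewrite thickeningE//.
  by exists (proj X y) => //; apply: frob_convex => //; rewrite subrr frob0.
Qed.

End Tubular.

Lemma frob_average (R : realType) m n (I : eqType) (s : seq I) (w : I -> R)
    (F : I -> 'M[R]_(m, n)) (C : 'M[R]_(m, n)) (r : R) :
  (forall i, 0 <= w i) ->
  (forall i, i \in s -> 0 < w i -> frob (F i - C) < r) ->
  0 < \sum_(i <- s) w i ->
  frob ((\sum_(i <- s) w i)^-1 *: (\sum_(i <- s) w i *: F i) - C) < r.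
Proof.
move=> w0 Fr W0.
(* Without the normalization, the claim is additive in s and yields to induction. *)
suff : frob (\sum_(i <- s) w i *: F i - (\sum_(i <- s) w i) *: C) <
    (\sum_(i <- s) w i) * r.
  move: W0; move: (\sum_(i <- s) w i) => W W0 h.
  rewrite -(ltr_pM2l W0) -{1}(ger0_norm (ltW W0)) -frobZ scalerBr scalerA.
  by rewrite divff ?scale1r// gt_eqF.
elim: s Fr W0 => [|i s IH] Fr; first by rewrite big_nil ltxx.
rewrite !big_cons => W0; set S := \sum_(j <- s) _ *: _.
have S0 : 0 <= \sum_(j <- s) w j by exact: sumr_ge0.
have -> : w i *: F i + S - (w i + \sum_(j <- s) w j) *: C =
    w i *: (F i - C) + (S - (\sum_(j <- s) w j) *: C).
  by rewrite scalerBr scalerDl opprD addrACA.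
apply: le_lt_trans (frobD _ _) _; rewrite frobZ ger0_norm// mulrDl.
have Fi : 0 < w i -> w i * frob (F i - C) < w i * r.
  by move=> wi; rewrite ltr_pM2l// Fr ?mem_head.
have {}IH := IH (fun j js => Fr j (mem_behead (s := i :: s) js)).
have [wi|wi] := ltP 0 (w i); last first.
  have wi0 : w i = 0 by apply/eqP; rewrite eq_le wi w0.
  by rewrite wi0 !mul0r !add0r; apply: IH; rewrite wi0 add0r in W0.
have [/IH|Ws] := ltP 0 (\sum_(j <- s) w j).
  by move=> h; rewrite ltrD// Fi.
(* The tail has total weight zero, so strictness comes from the head alone. *)
have Ws0 : \sum_(j <- s) w j = 0 by apply/eqP; rewrite eq_le Ws S0.
rewrite Ws0 mul0r addr0 scale0r subr0 (_ : S = 0) ?frob0 ?addr0 ?Fi//.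
rewrite /S big1_seq// => j /andP[_ js].
have /eqP := Ws0; rewrite psumr_eq0; last by move=> ? _; exact: w0.
by move=> /allP/(_ j js)/= /eqP ->; rewrite scale0r.
Qed.

(** * Pointwise convergence and coordinates of the Cech complex *)

Section Pointwise.
Context {R : realType}.

Lemma within_ptwsP (X V : topologicalType) (A : set X) (f : X -> {ptws V -> R})
  :
  {within A, continuous f} <->
  (forall p, {within A, continuous (fun x => f x p)}).
Proof.
split=> [cf p|cf].
  apply/subspace_continuousP => x Ax.
  have /subspace_continuousP/(_ x Ax)/pointwise_cvgP := cf.
  by move=> /(_ p).
apply/subspace_continuousP => x Ax; apply/pointwise_cvgP => p.
by have /subspace_continuousP/(_ x Ax) := cf p.
Qed.

Lemma eval_continuous (V : topologicalType) (p : V) :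
  continuous (fun c : {ptws V -> R} => c p).
Proof.
by move=> c; exact: ((@pointwise_cvgP V R (nbhs c) c _).1 cvg_id p).
Qed.

Lemma continuous_pospart (T : topologicalType) (f : T -> R) :
  continuous f -> continuous (fun x => Num.max 0 (f x)).
Proof.
move=> cf x.
exact: (@continuous_max _ _ (fun=> 0) f x (@cst_continuous _ _ _ x) (cf x)).
Qed.

Lemma continuous_sumr (V : normedModType R) (T : topologicalType) (I : Type)
    (s : seq I) (F : I -> T -> V) :
  (forall i, continuous (F i)) -> continuous (fun x => \sum_(i <- s) F i x).
Proof.
by move=> cF; apply: continuous_big => // x; exact: add_continuous.
Qed.

End Pointwise.

Section CechComplex.
Context {R : realType} {N : nat}.
Implicit Types (P : set 'rV[R]_N) (w : 'rV[R]_N -> R) (y z p : 'rV[R]_N).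

Definition normalize P w : {ptws 'rV[R]_N -> R} :=
  fun p => w p / \sum_(q <- fset_set P) w q.

Lemma in_fset_setP P p : finite_set P -> (p \in fset_set P) <-> P p.
Proof. by move=> finP; rewrite in_fset_set//; split=> [/set_mem|/mem_set]. Qed.

Lemma sum_fset_gt0 P w p : finite_set P -> (forall q, 0 <= w q) -> P p ->
  0 < w p -> 0 < \sum_(q <- fset_set P) w q.
Proof.
move=> finP w0 Pp wp; rewrite lt_def sumr_ge0// andbT psumr_eq0//.
apply/negP => /allP/(_ p); rewrite in_fset_set// mem_set// => /(_ isT)/=.
by rewrite gt_eqF.
Qed.

Lemma normalize_cech P w alpha : finite_set P -> (forall q, 0 <= w q) ->
  (forall q, ~ P q -> w q = 0) -> (exists p, 0 < w p) ->
  (exists y, forall p, 0 < w p -> frob (y - p) < alpha) ->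
  cech P alpha (normalize P w).
Proof.
move=> finP w0 wP [p wp] [y wy].
have Pp : P p by apply: contrapT => /wP wp0; rewrite wp0 ltxx in wp.
have S0 := sum_fset_gt0 finP w0 Pp wp; split.
- by move=> q; rewrite divr_ge0// ltW.
- by move=> q /wP wq; rewrite /normalize wq mul0r.
- rewrite fsbig_finite// /normalize -mulr_suml divff// gt_eqF//.
- exists y => q; rewrite /normalize => wq; apply: wy.
  by move: wq; rewrite pmulr_lgt0// invr_gt0.
Qed.

Lemma normalize_gt0 P w p : (forall q, 0 <= w q) -> 0 < normalize P w p -> 0 <
  w p.
Proof.
move=> w0; rewrite /normalize => h; rewrite lt_def w0 andbT.
by apply: contraTneq h => ->; rewrite mul0r ltxx.
Qed.

Lemma normalize_continuous (T : topologicalType) (A : set T) P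
    (w : T -> 'rV[R]_N -> R) :
  (forall p, {within A, continuous (fun x => w x p)}) ->
  (forall x, A x -> 0 < \sum_(q <- fset_set P) w x q) ->
  {within A, continuous (fun x => normalize P (w x))}.
Proof.
move=> cw w0; apply/within_ptwsP => p; rewrite continuous_subspace_in => x Ax.
apply: (@continuousM R (subspace A) (fun x => w x p) (fun x => (\sum_(q <-
  fset_set P) w x q)^-1)).
  exact: cw.
apply: (@continuousV R (subspace A) (fun x => \sum_(q <- fset_set P) w x q)).
  by rewrite gt_eqF// w0//; exact/set_mem.
exact: (@continuous_sumr R R^o (subspace A) _ _ (fun q x => w x q)).
Qed.

(** A tent function supported on B(p, alpha); the indicator makes it vanish off P, as [cech]
    demands. *)
Definition nerve_weight P alpha y p : R :=
  (p \in P)%:R * Num.max 0 (alpha - frob (y - p)).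

(** The partition of unity subordinate to the balls, as a map to the nerve. *)
Definition nerve_map P alpha y := normalize P (nerve_weight P alpha y).

Lemma nerve_weight_ge0 P alpha y p : 0 <= nerve_weight P alpha y p.
Proof. by rewrite mulr_ge0// le_max lexx. Qed.

Lemma nerve_weight_gt0 P alpha y p :
  0 < nerve_weight P alpha y p <-> P p /\ frob (y - p) < alpha.
Proof.
rewrite /nerve_weight; have [Pp|nPp] := pselect (P p); last first.
  by rewrite memNset// mul0r ltxx; split=> // -[].
by rewrite mem_set// mul1r lt_max ltxx/= subr_gt0; split=> // -[].
Qed.

Lemma nerve_map_gt0 P alpha y p : 0 < nerve_map P alpha y p ->
  P p /\ frob (y - p) < alpha.
Proof.
by move=> /(normalize_gt0 (nerve_weight_ge0 _ _ _))/nerve_weight_gt0.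
Qed.

Lemma nerve_map_cech P alpha y : finite_set P -> 0 < alpha ->
  thickening P alpha y -> cech P alpha (nerve_map P alpha y).
Proof.
move=> finP a0; rewrite thickeningE// => -[p Pp yp].
apply: normalize_cech => //.
- exact: nerve_weight_ge0.
- by move=> q nPq; rewrite /nerve_weight memNset// mul0r.
- by exists p; exact/nerve_weight_gt0.
- by exists y => q /nerve_weight_gt0[].
Qed.

Lemma nerve_map_continuous P alpha : finite_set P -> 0 < alpha ->
  {within thickening P alpha, continuous (nerve_map P alpha)}.
Proof.
move=> finP a0; apply: normalize_continuous => [p|y].
  apply: continuous_subspaceT => y.
  apply: (@continuousM _ _ (fun=> _) (fun y => Num.max 0 (alpha - frob (y -
    p)))).
    exact: cst_continuous.
  apply: continuous_pospart => {}y.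
  apply: (@continuousB R R^o _ (fun=> alpha) (fun y => frob (y - p))).
    exact: cst_continuous.
  rewrite (_ : (fun _ => _) = (fun y => frob (p - y))); last first.
    by apply/funext => z; rewrite frobBC.
  exact: frob_sub_continuous.
rewrite thickeningE// => -[p Pp yp].
apply: (@sum_fset_gt0 _ _ p) => //; first exact: nerve_weight_ge0.
exact/nerve_weight_gt0.
Qed.

(** The common y says that the supports of [f0 x] and [f1 x] span one simplex, which contains the
    segment between them. *)
Lemma cech_line (X : topologicalType) (A : set X) P alpha
    (f0 f1 : X -> {ptws 'rV[R]_N -> R}) : finite_set P ->
  {within A, continuous f0} -> {within A, continuous f1} ->
  (forall x, A x -> [/\ cech P alpha (f0 x), cech P alpha (f1 x) &
    exists y, forall p, 0 < f0 x p \/ 0 < f1 x p -> frob (y - p) < alpha]) ->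
  homotopic R A (cech P alpha) f0 f1.
Proof.
move=> finP /within_ptwsP cf0 /within_ptwsP cf1 f01.
exists (fun tx p => (1 - tx.1) * f0 tx.2 p + tx.1 * f1 tx.2 p); split.
- apply/within_ptwsP => p.
  have c1 := @within_fst R _ A; have cf0p := within_snd (R := R) (cf0 p).
  exact: (continuous_line (V := R^o) c1 cf0p (within_snd (R := R) (cf1 p))).
- move=> [t x] [/= + /f01[[p0 z0 s0 _] [p1 z1 s1 _] [y yp]]].
  rewrite in_itv/= => /andP[t0 t1]; split.
  + by move=> p; rewrite addr_ge0// mulr_ge0// subr_ge0.
  + by move=> p nPp; rewrite z0// z1// !mulr0 addr0.
  + rewrite fsbig_finite//= big_split/= -!mulr_sumr -!fsbig_finite// s0 s1.
    by rewrite !mulr1 subrK.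
  + exists y => p; apply: contraPP => nyp; apply/negP; rewrite -leNgt.
    have [f0p|f0p] := ltP 0 (f0 x p); first by case: nyp; apply: yp; left.
    have [f1p|f1p] := ltP 0 (f1 x p); first by case: nyp; apply: yp; right.
    by rewrite -oppr_ge0 opprD -!mulrN addr_ge0// mulr_ge0 ?subr_ge0 ?oppr_ge0.
- by move=> x _; apply/funext => p /=; rewrite subr0 mul1r mul0r addr0.
- by move=> x _; apply/funext => p /=; rewrite subrr mul0r mul1r add0r.
Qed.

(** One witness for each of the finitely many subsets of P is enough: c uses that of its support.
    Subsets without witness contribute the harmless value 0. *)
Lemma cech_witnesses P alpha : finite_set P -> exists Y : seq 'rV[R]_N,
  forall c, cech P alpha c ->
    exists2 z, z \in Y & forall p, 0 < c p -> frob (z - p) < alpha.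
Proof.
move=> finP.
pose wit (A : {fset 'rV[R]_N}) := xget 0 [set z | forall p, p \in A -> frob (z
  - p) < alpha].
exists [seq wit A | A <- fpowerset (fset_set P)] => c [c0 cP _ [y yc]].
pose A := [fset p in fset_set P | 0 < c p]%fset.
have AE p : (p \in A) = (0 < c p).
  rewrite !inE/= in_fset_set//; apply/andP/idP => [[]//|cp]; split=> //.
  by apply/mem_set; apply: contrapT => /cP cp0; rewrite cp0 ltxx in cp.
exists (wit A); first by apply: map_f; rewrite fpowersetE; exact: fset_sub.
have : [set z | forall p, p \in A -> frob (z - p) < alpha] (wit A).
  by apply: xgetPex; exists y => p; rewrite AE; exact: yc.
by move=> h p cp; apply: h; rewrite AE.
Qed.

End CechComplex.

(** * The nerve of the balls around P *)

Section NerveTheorem.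
Context {R : realType} {N : nat}.
Implicit Types (P : set 'rV[R]_N) (y z p : 'rV[R]_N) (c : {ptws 'rV[R]_N -> R}).

(** The successor makes |P| times the threshold less than 1, so coefficients of sum 1 cannot all
    stay below it. *)
Definition threshold P : R := ((size (fset_set P)).+1)%:R^-1.

Lemma threshold_gt0 P : 0 < threshold P.
Proof. by rewrite invr_gt0. Qed.

Lemma cech_over_threshold P alpha c : finite_set P -> cech P alpha c ->
  exists2 p, P p & threshold P < c p.
Proof.
move=> finP [c0 cP c1 _]; apply: contrapT => ncp.
have ct p : p \in fset_set P -> c p <= threshold P.
  move=> /(in_fset_setP _ finP) Pp; rewrite leNgt; apply/negP => cp.
  by apply: ncp; exists p.
have : \sum_(p <- fset_set P) c p < 1.
  apply: (@le_lt_trans _ _ (\sum_(p <- fset_set P) threshold P)).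
    by rewrite big_seq [leRHS]big_seq; apply: ler_sum.
  rewrite big_const_seq count_predT iter_addr_0 -[_ *+ _]mulr_natl /threshold.
  by rewrite ltr_pdivrMr// mul1r ltr_nat.
by rewrite -fsbig_finite// c1 ltxx.
Qed.

(** Moves c within its own simplex onto the vertices whose balls are sure to contain the witness
    average. *)
Definition shrink P c := normalize P (fun p => Num.max 0 (c p - threshold P)).

Lemma shrink_weight_gt0 P c p :
  (0 < Num.max 0 (c p - threshold P)) = (threshold P < c p).
Proof. by rewrite lt_max ltxx subr_gt0. Qed.

Lemma shrink_gt0 P c p : 0 < shrink P c p -> threshold P < c p.
Proof.
by move/normalize_gt0; rewrite shrink_weight_gt0; apply=> q;
  rewrite le_max lexx.
Qed.

Lemma shrink_cech P alpha c : finite_set P -> cech P alpha c ->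
  cech P alpha (shrink P c).
Proof.
move=> finP cc; have [p Pp cp] := cech_over_threshold finP cc.
have [c0 cP _ [y yc]] := cc; apply: normalize_cech => //.
- by move=> q; rewrite le_max lexx.
- by move=> q /cP ->; rewrite sub0r max_l// oppr_le0 ltW// threshold_gt0.
- by exists p; rewrite shrink_weight_gt0.
- exists y => q; rewrite shrink_weight_gt0 => cq; apply: yc.
  exact: lt_trans (threshold_gt0 P) cq.
Qed.

Lemma within_eval (A : set {ptws 'rV[R]_N -> R}) p :
  {within A, continuous (fun c => c p)}.
Proof. by apply: continuous_subspaceT; exact: eval_continuous. Qed.

Lemma shrink_continuous P alpha : finite_set P ->
  {within cech P alpha, continuous (shrink P)}.
Proof.
move=> finP; apply: normalize_continuous => [p|c cc].
  apply: continuous_pospart => c.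
  apply: (@continuousB R R^o (subspace (cech P alpha)) (fun c => c p) (fun=>
    threshold P) c).
    exact: within_eval.
  exact: cst_continuous.
have [p Pp cp] := cech_over_threshold finP cc.
apply: (@sum_fset_gt0 _ _ _ _ p) => //; last by rewrite shrink_weight_gt0.
by move=> q; rewrite le_max lexx.
Qed.

(* Positive exactly when z lies in all the balls B(p, alpha) with
   threshold P <= c p. *)
Definition witness_weight P alpha c z : R :=
  \prod_(p <- fset_set P | alpha <= frob (z - p)) Num.max 0 (threshold P - c p).

(** Unlike the choice of one witness for each c, this average depends continuously on c. *)
Definition witness_average P alpha (Y : seq 'rV[R]_N) c : 'rV[R]_N :=
  (\sum_(z <- Y) witness_weight P alpha c z)^-1 *:
    (\sum_(z <- Y) witness_weight P alpha c z *: z).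

Lemma witness_weight_ge0 P alpha c z : 0 <= witness_weight P alpha c z.
Proof. by apply: prodr_ge0 => p _; rewrite le_max lexx. Qed.

Section Witnesses.
Variables (P : set 'rV[R]_N) (alpha : R) (Y : seq 'rV[R]_N).
Hypothesis finP : finite_set P.
Hypothesis witY : forall c, cech P alpha c ->
  exists2 z, z \in Y & forall p, 0 < c p -> frob (z - p) < alpha.

(** A witness z of the support of c has positive weight: c vanishes at every p whose ball misses z,
    so each factor is at least the threshold. *)
Lemma sum_witness_weight_gt0 c : cech P alpha c ->
  0 < \sum_(z <- Y) witness_weight P alpha c z.
Proof.
move=> cc; have [z zY zc] := witY cc.
rewrite lt_def sumr_ge0 ?andbT ?psumr_eq0 => [|? _|? _];
  try exact: witness_weight_ge0.
apply/negP => /allP/(_ z zY)/=; rewrite gt_eqF//; apply: prodr_gt0 => p zp.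
rewrite lt_max subr_gt0; apply/orP; right; apply: le_lt_trans (threshold_gt0 P).
by rewrite leNgt; apply/negP => /zc; rewrite ltNge zp.
Qed.

(** A z outside B(p, alpha) has a zero factor at p, so only points of this convex ball are
    averaged. *)
Lemma witness_average_near c p : cech P alpha c -> P p -> threshold P <= c p ->
  frob (witness_average P alpha Y c - p) < alpha.
Proof.
move=> cc Pp cp; apply: frob_average.
- exact: witness_weight_ge0.
- move=> z _ wz; rewrite ltNge; apply/negP => zp.
  suff w0 : witness_weight P alpha c z = 0 by rewrite w0 ltxx in wz.
  apply/eqP; rewrite prodf_seq_eq0; apply/hasP; exists p.
    exact/in_fset_setP.
  by rewrite zp/= max_l// subr_le0.
- exact: sum_witness_weight_gt0.
Qed.

Lemma witness_average_thickening c : 0 < alpha -> cech P alpha c ->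
  thickening P alpha (witness_average P alpha Y c).
Proof.
move=> a0 cc; have [p Pp cp] := cech_over_threshold finP cc.
by rewrite thickeningE//; exists p => //; apply: witness_average_near => //;
  exact: ltW.
Qed.

Lemma witness_average_continuous :
  {within cech P alpha, continuous (witness_average P alpha Y)}.
Proof.
have cw z : {within cech P alpha, continuous (fun c => witness_weight P alpha c
  z)}.
  apply: continuous_big => [x|p _]; first exact: mul_continuous.
  apply: continuous_pospart => c.
  apply: (@continuousB R R^o (subspace (cech P alpha)) (fun=> threshold P) (fun
    c => c p) c).
    exact: cst_continuous.
  exact: within_eval.
rewrite continuous_subspace_in => c /set_mem cc.
apply: (@continuousZ _ _ (subspace (cech P alpha))
  (fun c => (\sum_(z <- Y) witness_weight P alpha c z)^-1)
  (fun c => \sum_(z <- Y) witness_weight P alpha c z *: z)).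
  apply: (@continuousV R (subspace (cech P alpha))
    (fun c => \sum_(z <- Y) witness_weight P alpha c z)).
    by rewrite gt_eqF// sum_witness_weight_gt0.
  by apply: (@continuous_sumr R R^o (subspace (cech P alpha))) => z; exact: cw.
apply: (@continuous_sumr _ _ (subspace (cech P alpha))) => z e.
exact: (@continuousZ _ _ _ _ (fun=> z) e (cw z e) (@cst_continuous _ _ _ e)).
Qed.

End Witnesses.

(** The inverse is [proj M \o G]. On the complex, the homotopy runs from the round trip to
    [nerve_map P alpha \o G], by sliding along the segments in U, then to [shrink P] and to the
    identity. *)
Lemma nerve_map_homotopy_equivalence (M P : set 'rV[R]_N) alpha r :
  compact M -> M !=set0 -> uniquely_closest M r -> finite_set P -> 0 < alpha ->
  M `<=` thickening P alpha ->
  (forall y, thickening P alpha y -> frob (y - proj M y) < r) ->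
  (forall y t, thickening P alpha y -> 0 <= t <= 1 ->
    thickening P alpha ((1 - t) *: proj M y + t *: y)) ->
  homotopy_equivalence R M (cech P alpha) (nerve_map P alpha).
Proof.
move=> cM M0 uM finP a0 MP Pr Pseg.
have [Y witY] := cech_witnesses alpha finP.
set U := thickening P alpha; pose G := witness_average P alpha Y.
have GU : set_fun (cech P alpha) U G.
  by move=> c; exact: witness_average_thickening.
have cG : {within cech P alpha, continuous G} by exact:
  witness_average_continuous.
have nU : set_fun U (cech P alpha) (nerve_map P alpha).
  by move=> y; exact: nerve_map_cech.
have cn : {within U, continuous (nerve_map P alpha)} by exact:
  nerve_map_continuous.
have projM y : M (proj M y) by have [] := projP y cM M0.
have cproj : {within U, continuous (proj M)}.
  apply: continuous_subspaceW (proj_continuous cM uM) => y /Pr yr.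
  by exists (proj M y).
have cM_n : {within M, continuous (nerve_map P alpha)}.
  exact: continuous_subspaceW cn.
have nM : set_fun M (cech P alpha) (nerve_map P alpha) by move=> y /MP/nU.
have cid (A : set 'rV[R]_N) : {within A, continuous idfun}.
  by apply: continuous_subspaceT => x; exact: cvg_id.
split=> //; exists (proj M \o G); split.
- by move=> c _; exact: projM.
- exact: within_comp GU cG cproj.
- have step : homotopic R M U (G \o nerve_map P alpha) idfun.
    apply: homotopic_line => [|//|t x t01 Mx].
      exact: within_comp nM cM_n cG.
    (* Where the coefficient of [nerve_map] exceeds the threshold, B(p, alpha) contains both x and
       its image under the round trip. *)
    have nx := nM x Mx; have [p Pp xp] := cech_over_threshold finP nx.
    rewrite /U thickeningE//; exists p => //; apply: frob_convex => //.
      by apply: witness_average_near => //; exact: ltW.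
    by have [] := nerve_map_gt0 (lt_trans (threshold_gt0 P) xp).
  have := @homotopic_postcomp R _ _ _ M U M (proj M) _ _ _ cproj step.
  move=> /(_ (fun y _ => projM y)) h; apply: homotopic_trans h _.
  apply: homotopic_refl => [x _|//|x Mx]; first exact: projM.
    by apply: continuous_subspaceW cproj.
  exact: proj_id.
- apply: (@homotopic_trans _ _ _ _ _ _ (nerve_map P alpha \o G)).
    have step : homotopic R U U (proj M) idfun.
      by apply: homotopic_line => // t y t01 Uy; exact: Pseg.
    exact: (homotopic_precomp GU cG (homotopic_postcomp nU cn step)).
  apply: (@homotopic_trans _ _ _ _ _ _ (shrink P)).
    apply: cech_line => //; first exact: within_comp GU cG cn.
      exact: shrink_continuous.
    (* [G c] itself lies in the balls of both supports. *)
    move=> c cc; split; [exact/nU/GU|exact: shrink_cech|exists (G c) => p].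
    case=> [/nerve_map_gt0[]//|/shrink_gt0 cp].
    have [Pp|nPp] := pselect (P p).
      by apply: witness_average_near => //; exact: ltW.
    by have [_ /(_ p nPp) cp0 _ _] := cc; have := threshold_gt0 P;
      rewrite ltNge ltW// -cp0.
  apply: cech_line => //; first exact: shrink_continuous.
    by apply: continuous_subspaceT => c; exact: cvg_id.
  move=> c cc; split=> //; first exact: shrink_cech.
  have [_ _ _ [y yc]] := cc; exists y => p [/shrink_gt0 cp|]; last exact: yc.
  by apply: yc; exact: lt_trans (threshold_gt0 P) cp.
Qed.

End NerveTheorem.

(** * Sampling conditions *)

Section Sampling.
Context {R : realType}.

Lemma scale_range (eps tau alpha : R) : 0 < eps -> 0 < tau ->
  eps < (3 - Num.sqrt 8) * tau ->
  ((eps + tau) - Num.sqrt (eps ^+ 2 + tau ^+ 2 - 6 * tau * eps)) / 2 < alpha ->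
  alpha < ((eps + tau) + Num.sqrt (eps ^+ 2 + tau ^+ 2 - 6 * tau * eps)) / 2 ->
  [/\ alpha ^+ 2 + 2 * tau * eps < (eps + tau) * alpha, eps < alpha &
      alpha + eps < tau].
Proof.
set D := eps ^+ 2 + _ - _; move=> eps0 tau0 eps_tau al ar.
(* The interval contains alpha, so it is nonempty. Its ends are the roots of z^2 - (eps + tau) z + 2
   tau eps, which is therefore negative at alpha. *)
have s0 : 0 < Num.sqrt D by lra.
have D0 : 0 < D by rewrite -sqrtr_gt0.
have sD : Num.sqrt D ^+ 2 = D by rewrite sqr_sqrtr// ltW.
have quad : alpha ^+ 2 + 2 * tau * eps < (eps + tau) * alpha.
  have : 0 < (alpha - (eps + tau - Num.sqrt D) / 2) * ((eps + tau + Num.sqrt D)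
    / 2 - alpha).
    by rewrite mulr_gt0 ?subr_gt0.
  have -> : (alpha - (eps + tau - Num.sqrt D) / 2) * ((eps + tau + Num.sqrt D)
    / 2 - alpha) =
     (eps + tau) * alpha - alpha ^+ 2 - (eps + tau) ^+ 2 / 4 + Num.sqrt D ^+ 2
       / 4 by field.
  by rewrite sD /D; lra.
(* A rational bound, enough to get 3 eps < tau. *)
have s8 : 8 / 3 < Num.sqrt 8 :> R.
  rewrite -(@ltr_pXn2r _ 2)// ?nnegrE ?sqrtr_ge0 ?divr_ge0// sqr_sqrtr//.
  by rewrite expr_div_n; lra.
have eps3 : 3 * eps < tau.
  have : (3 - Num.sqrt 8) * tau < (1 / 3) * tau by rewrite ltr_pM2r//; lra.
  by lra.
clear -quad eps0 tau0 eps3.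
(* The products below are the quadratic at alpha minus tau eps and minus 2 eps^2 respectively;
   either being nonnegative contradicts its sign. *)
split=> //; rewrite ltNge; apply/negP => h.
  have : 0 <= (eps - alpha) * (tau - alpha) by apply: mulr_ge0; lra.
  have := mulr_gt0 eps0 tau0; lra.
have : 0 <= (alpha - (tau - eps)) * (alpha - 2 * eps) by apply: mulr_ge0; lra.
have : 0 < eps ^+ 2 by rewrite exprn_gt0.
lra.
Qed.

(* s |-> s ^+ 2 - 2 * s * b + c is the squared distance from a point to a ray;
   its values at s, rho, tau are related by Lagrange interpolation. *)
Lemma ray_quadratic_lt (alpha eps tau rho s b c : R) :
  0 < eps -> alpha + eps < tau ->
  alpha ^+ 2 + 2 * tau * eps < (eps + tau) * alpha ->
  rho < tau -> alpha - eps <= s <= rho ->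
  rho ^+ 2 - 2 * rho * b + c < alpha ^+ 2 ->
  (tau - eps) ^+ 2 <= tau ^+ 2 - 2 * tau * b + c ->
  s ^+ 2 - 2 * s * b + c < alpha ^+ 2.
Proof.
move=> eps0 aet quad rt /andP[ls sr] hrho htau.
have ts : 0 < tau - s by lra.
rewrite -(ltr_pM2l (_ : 0 < tau - rho)); last by lra.
have -> : (tau - rho) * (s ^+ 2 - 2 * s * b + c) =
    (tau - s) * (rho ^+ 2 - 2 * rho * b + c) -
    (rho - s) * (tau ^+ 2 - 2 * tau * b + c) + (rho - s) * ((tau - rho) * (tau
      - s)).
  by ring.
have h1 : (tau - s) * (rho ^+ 2 - 2 * rho * b + c) < (tau - s) * alpha ^+ 2.
  by rewrite ltr_pM2l.
have h2 : (rho - s) * (tau - eps) ^+ 2 <= (rho - s) * (tau ^+ 2 - 2 * tau * b +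
  c).
  by rewrite ler_wpM2l//; lra.
(* Both tau - rho and tau - s are at most tau - (alpha - eps), whose square is below (tau - eps)^2 -
   alpha^2 exactly by the quadratic condition on alpha. *)
have h3 : (rho - s) * ((tau - rho) * (tau - s)) <= (rho - s) * ((tau - eps) ^+
  2 - alpha ^+ 2).
  rewrite ler_wpM2l//; first by lra.
  have : (tau - rho) * (tau - s) <= (tau - (alpha - eps)) * (tau - (alpha -
    eps)).
    by apply: ler_pM; lra.
  by lra.
by lra.
Qed.

Variables (N : nat) (M P : set 'rV[R]_N) (alpha eps tau : R).
Hypothesis cM : compact M.
Hypothesis uM : uniquely_closest M tau.
Hypothesis eps0 : 0 < eps.
Hypothesis eps_alpha : eps < alpha.
Hypothesis alpha_tau : alpha + eps < tau.
Hypothesis quad : alpha ^+ 2 + 2 * tau * eps < (eps + tau) * alpha.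
Hypothesis coverM : forall x, M x -> exists2 p, P p & frob (p - x) < eps.
Hypothesis coverP : forall p, P p -> exists2 x, M x & frob (p - x) < eps.

Let alpha0 : 0 < alpha. Proof. exact: lt_trans eps_alpha. Qed.
Let tau0 : 0 < tau. Proof. by apply: lt_trans alpha_tau; rewrite addr_gt0. Qed.

Lemma sampled_sub_thickening : M `<=` thickening P alpha.
Proof.
move=> x /coverM[p Pp px]; rewrite thickeningE//; exists p => //.
by rewrite frobBC; exact: lt_trans eps_alpha.
Qed.

Lemma sample_thickening_near y : thickening P alpha y -> frob (y - proj M y) <
  tau.
Proof.
rewrite thickeningE// => -[p Pp yp]; have [x Mx px] := coverP Pp.
have [_ /(_ x Mx) yx] := projP y cM (ex_intro _ x Mx).
apply: le_lt_trans yx _; apply: le_lt_trans (frob_triangle p _ _) _.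
by apply: lt_trans alpha_tau; rewrite ltrD.
Qed.

(* Niyogi, Smale and Weinberger. *)
Lemma sample_thickening_segment y t : thickening P alpha y -> 0 <= t <= 1 ->
  thickening P alpha ((1 - t) *: proj M y + t *: y).
Proof.
move=> Uy /andP[t0 t1]; have := sample_thickening_near Uy.
move: Uy; rewrite !thickeningE// => -[p Pp yp]; have [x0 Mx0 px0] := coverP Pp.
have [Mx _] := projP y cM (ex_intro _ x0 Mx0).
have := tangent_ball_disjoint (y := y) cM uM _ Mx0.
move: (proj M y) Mx => x Mx; move erho : (frob (y - x)) => rho tangent rt.
have -> : (1 - t) *: x + t *: y = x + t *: (y - x).
  by rewrite scalerBl scale1r scalerBr addrAC addrA.
have vx : frob (t *: (y - x)) = t * rho by rewrite frobZ ger0_norm// erho.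
(* Within alpha - eps of x, a sample point p' near x serves; further out, the original p does. *)
have [small|large] := leP (t * rho) (alpha - eps).
  have [p' Pp' p'x] := coverM Mx; exists p' => //.
  apply: le_lt_trans (frob_triangle x _ _) _.
  by rewrite addrAC subrr add0r vx (frobBC x) -ltrBrDl (lt_le_trans p'x)//
    lerBrDl -lerBrDr.
exists p => //; have rho0 : 0 < rho.
  rewrite lt_def -erho frob_ge0 andbT erho; apply: contraTneq large => ->.
  by rewrite mulr0 -leNgt subr_ge0 ltW.
rewrite -(@ltr_pXn2r _ 2)// ?nnegrE ?frob_ge0 ?(ltW alpha0)//.
pose b := dot (p - x) (y - x) / rho; pose c := frob (p - x) ^+ 2.
have ray s : frob (x + (s / rho) *: (y - x) - p) ^+ 2 = s ^+ 2 - 2 * s * b + c.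
  rewrite (addrC x) -addrA -(opprB p x) sqr_frobB dotZl (dotC (y - x))
    sqr_frobZ erho.
  by rewrite -/c /b; field; rewrite gt_eqF.
have -> : t = t * rho / rho by rewrite mulfK// gt_eqF.
rewrite ray; apply: (ray_quadratic_lt eps0 alpha_tau quad rt).
- by rewrite ltW//= ger_pMl.
- rewrite -ray divff ?gt_eqF// scale1r (addrC x) subrK.
  by rewrite ltr_pXn2r ?nnegrE ?frob_ge0 ?(ltW alpha0).
have te0 : 0 <= tau - eps by rewrite subr_ge0 ltW// (lt_trans _ alpha_tau)//
  ltrDr.
rewrite -ray ler_pXn2r ?nnegrE ?frob_ge0//.
set o := x + _ *: _.
(* o is the centre of the tangent ball of radius tau, which x0 cannot enter; hence p stays at
   distance at least tau - eps from o. *)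
have : tau <= frob (o - x0).
  rewrite -(@ler_pXn2r _ 2)// ?nnegrE ?frob_ge0 ?(ltW tau0)// /o.
  rewrite (addrC x) -addrA -(opprB x0 x) sqr_frobB dotZl (dotC (y - x))
    sqr_frobZ erho.
  have -> : (tau / rho) ^+ 2 * rho ^+ 2 = tau ^+ 2 by field; rewrite gt_eqF.
  rewrite -addrA lerDl addrC subr_ge0 mulrA.
  by rewrite -(ler_pM2r rho0) (le_trans _ (tangent rt))// mulrA mulrAC divfK
    ?gt_eqF.
have := frob_triangle p o x0.
move: (frob (o - x0)) (frob (o - p)) (frob (p - x0)) px0 => d1 d2 d3 *.
by clear tangent ray; lra.
Qed.

End Sampling.

(** * Comparison of the maps to the Grassmannian *)

Lemma lipschitz_continuous (R : realType) (ell : R) m n p q (A : set 'M[R]_(m,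
  n))
    (f : 'M[R]_(m, n) -> 'M[R]_(p, q)) : 0 < ell -> lipschitz_map ell A f ->
  {within A, continuous f}.
Proof.
move=> l0 lipf; apply/subspace_continuousP => x Ax; apply/cvg_frobP => e e0.
rewrite near_withinE; have := near_frob x (divr_gt0 e0 l0); apply: filterS => y.
rewrite ltr_pdivlMr// mulrC => yx Ay; exact: le_lt_trans (lipf y x Ay Ax) yx.
Qed.

Lemma cech_map_continuous (R : realType) N n (P : set 'rV[R]_N)
    (g : 'rV[R]_N -> 'M[R]_n) (A : set {ptws 'rV[R]_N -> R}) : finite_set P ->
  {within A, continuous (cech_map P g)}.
Proof.
move=> finP; rewrite (_ : cech_map P g = fun c => \sum_(p <- fset_set P) c p *:
  g p).
  apply: (@continuous_sumr _ _ (subspace A)) => p c.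
  apply: (@continuousZ _ _ (subspace A) (fun c => c p) (fun=> g p)).
    exact: within_eval.
  exact: cst_continuous.
by apply/funext => c; rewrite /cech_map fsbig_finite.
Qed.

Lemma cech_map_near (R : realType) N n (P : set 'rV[R]_N) (alpha r : R)
    (g : 'rV[R]_N -> 'M[R]_n) c (C : 'M[R]_n) : finite_set P -> cech P alpha c
      ->
  (forall p, P p -> 0 < c p -> frob (g p - C) < r) ->
  frob (cech_map P g c - C) < r.
Proof.
move=> finP [c0 cP c1 _] gC.
have s1 : \sum_(p <- fset_set P) c p = 1 by rewrite -fsbig_finite.
have := @frob_average R n n _ (fset_set P) c g C r c0.
rewrite s1 invr1 scale1r /cech_map fsbig_finite//; apply=> // p.
by move/(in_fset_setP _ finP) => Pp; exact: gC.
Qed.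

Theorem theorem5p15 (R : realType) (N m d n : nat)
    (M : set 'rV[R]_N) (ell : R) (f : 'rV[R]_N -> 'M[R]_n)
    (P : set 'rV[R]_N) (g : 'rV[R]_N -> 'M[R]_n) (eps delta : R)
    (hMsmooth : smooth_submanifold m M)
    (hMcompact : compact M)
    (hMreach : (0 < reach M)%E)
    (hell : 0 < ell)
    (hfGr : set_fun M (Gr d n) f)
    (hflip : lipschitz_map ell M f)
    (hPfin : finite_set P)
    (hgGr : set_fun P (Gr d n) g)
    (heps : 0 < eps)
    (hdelta : 0 < delta)
    (hMP : forall x, M x -> exists2 p, P p & frob (p - x) < eps)
    (hPM : forall p, P p ->
       exists x, [/\ M x, frob (p - x) < eps & frob (g p - f x) < delta]) :
  approx_lipschitz (2 * (delta + ell * eps)) ell P g /\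
  forall tau : R, reach M = tau%:E ->
    eps < (3 - Num.sqrt 8) * tau ->
    forall alpha : R,
      alpha \in `]((eps + tau)
                    - Num.sqrt (eps ^+ 2 + tau ^+ 2 - 6 * tau * eps)) / 2,
                  ((eps + tau)
                    + Num.sqrt (eps ^+ 2 + tau ^+ 2 - 6 * tau * eps)) / 2[ ->
      alpha \in `]0, (Num.sqrt 2 / 2 - 2 * delta - 2 * ell * eps)
                       / (2 * ell)[ ->
      let Gr_r := thickening (Gr d n) (2 * (ell * alpha + ell * eps + delta)) in
      homotopy_equivalence R (Gr d n) Gr_r idfun /\
      exists h : 'rV[R]_N -> {ptws 'rV[R]_N -> R},
        homotopy_equivalence R M (cech P alpha) h /\
        homotopic R M Gr_r (cech_map P g \o h) (idfun \o f).
Proof.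
split.
  (* On the path g p, f x, f x', g p', the ends cost 2 delta and the middle ell (|p - p'| + 2
     eps). *)
  move=> p p' Pp Pp'; have [x [Mx px gx]] := hPM p Pp;
    have [x' [Mx' px' gx']] := hPM p' Pp'.
  have := frob_triangle (f x) (g p) (g p');
    have := frob_triangle (f x') (f x) (g p').
  have := hflip x x' Mx Mx'; rewrite (frobBC (f x') (g p')).
  have := frob_triangle p x x'; have := frob_triangle p' p x';
    rewrite (frobBC x p).
  move: (frob (p - x)) (frob (p' - x')) (frob (x - x')) (frob (p - x')) (frob
    (p - p')) px px'.
  move=> a a' b c e ha ha' h1 h2 h3; move: h3 gx gx'.
  move: (frob _) (frob _) (frob _) (frob _) (frob _) => u v w z k.
  have : ell * b <= ell * (e + 2 * eps) by rewrite ler_pM2l//; lra.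
  clear -h1; lra.
move=> tau reachM eps_tau alpha;
  rewrite !in_itv/= => /andP[al ar] /andP[alpha0 alpha_lt].
have tau0 : 0 < tau by rewrite -lte_fin -reachM.
have [quad eps_alpha alpha_tau] := scale_range heps tau0 eps_tau al ar.
set r := 2 * _.
have r0 : 0 < r by rewrite mulr_gt0 ?addr_gt0 ?mulr_gt0.
(* The second upper bound on alpha puts r in the range of [Gr_uniquely_closest]. *)
have r_lt : r <= Num.sqrt 2 / 2.
  by move: alpha_lt; rewrite ltr_pdivlMr ?mulr_gt0// /r => /ltW; clear; lra.
have uM : uniquely_closest M tau by apply: reach_uniquely_closest;
  rewrite reachM.
have coverP p : P p -> exists2 x, M x & frob (p - x) < eps.
  by move=> /hPM[x [Mx px _]]; exists x.
(* The empty set has infinite reach. *)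
have M0 : M !=set0.
  apply: contrapT => M0; have : ((tau + 1)%:E <= reach M)%E.
    apply: ereal_sup_ubound; exists (tau + 1) => //; split=> [|y x x'].
      by rewrite addr_ge0// ltW.
    rewrite thickeningE ?addr_gt0// => -[z Mz].
    by case: M0; exists z.
  by rewrite reachM lee_fin gerDl ler10.
split.
  apply: inclusion_homotopy_equivalence => //; first exact: Gr_compact.
  move=> A Q Q' [Z GZ AZ]; apply: Gr_uniquely_closest; exists Z => //.
  exact: lt_le_trans AZ r_lt.
have MU := sampled_sub_thickening heps eps_alpha hMP.
exists (nerve_map P alpha); split.
  apply: (nerve_map_homotopy_equivalence hMcompact M0 uM) => //.
  - exact: (sample_thickening_near hMcompact heps eps_alpha alpha_tau coverP).
  - move=> y t; exact: (sample_thickening_segment hMcompact uM heps eps_alpha).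
have nM : set_fun M (cech P alpha) (nerve_map P alpha).
  by move=> x Mx; apply: nerve_map_cech => //; exact: MU.
apply: homotopic_line.
- apply: (@within_comp _ _ _ M (cech P alpha)) => //;
  last exact: cech_map_continuous.
  by apply: continuous_subspaceW (nerve_map_continuous hPfin alpha0).
- exact: lipschitz_continuous hflip.
move=> t x t01 Mx; rewrite thickeningE//; exists (f x); first exact: hfGr.
apply: frob_convex => //; last by rewrite subrr frob0.
(* A vertex p with positive coefficient is within alpha of x, so |g p - f x| < delta + ell (alpha +
   eps) < r. *)
apply: cech_map_near (nM x Mx) _ => // p Pp /nerve_map_gt0[_ xp].
have [x' [Mx' px' gx']] := hPM p Pp.
apply: le_lt_trans (frob_triangle (f x') _ _) _.
have := hflip x' x Mx' Mx; have := frob_triangle p x' x.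
rewrite (frobBC x' p) (frobBC p x) /r.
move: gx'; move: (frob (f x' - f x)) (frob (g p - f x')) (frob (x' - x))
  (frob (p - x')) (frob (x - p)) px' xp.
move=> u v w a b aeps balpha vd wab uw.
have : ell * w <= ell * (alpha + eps) by rewrite ler_pM2l//; lra.
have := mulr_gt0 hell heps; have := mulr_gt0 hell alpha0.
by clear -uw vd hdelta; lra.
Qed.
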